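(* Assume (SH) and (H), and let $\phi:\mathbb{R}^n\to\mathbb{R}$ be locally Lipschitz. Let $\overline{x}:[t_0,T]\to\mathbb{R}^n$ be optimal for $\mathcal{P}(t_0,x_0)$ and let $\overline{p}:[t_0,T]\to\mathbb{R}^n$ be an arc such that $(\overline{x},\overline{p})$ satisfies, for a.e. $s\in[t_0,T]$, $$\dot{\overline{x}}(s)\in\partial_p^-H(\overline{x}(s),\overline{p}(s)),\qquad -\dot{\overline{p}}(s)\in\partial_x^-H(\overline{x}(s),\overline{p}(s)),$$ together with $\overline{x}(t_0)=x_0$ and $-\overline{p}(t_0)\in\partial_x^{-,pr}V(t_0,x_0)$. Then there exist constants $c,r>0$ such that, for all $t\in[t_0,T]$ and all $h\in B(0,r)$, $$V(t,\overline{x}(t)+h)-V(t,\overline{x}(t))\ \ge\ \langle-\overline{p}(t),h\rangle-c|h|^2,$$ and consequently, for all $t\in[t_0,T]$, $$-\overline{p}(t)\in\partial_x^{-,pr}V(t,\overline{x}(t))\quad\text{and}\quad(-\overline{p}(t),-cI_n)\in J_x^{2,-}V(t,\overline{x}(t)).$$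
   Context: Fix $T\in\mathbb{R}$, a multifunction $F:\mathbb{R}^n\rightrightarrows\mathbb{R}^n$ and $\phi:\mathbb{R}^n\to\mathbb{R}$. An arc is an absolutely continuous function on a compact interval. For $(t_0,x_0)\in(-\infty,T]\times\mathbb{R}^n$, the Mayer problem $\mathcal{P}(t_0,x_0)$ is to minimize $\phi(x(T))$ over all arcs $x:[t_0,T]\to\mathbb{R}^n$ with $\dot x(s)\in F(x(s))$ for a.e. $s\in[t_0,T]$ and $x(t_0)=x_0$; a minimizer is called optimal for $\mathcal{P}(t_0,x_0)$. The value function $V:(-\infty,T]\times\mathbb{R}^n\to\mathbb{R}$ is the infimum $V(t_0,x_0)$ of this problem. The Hamiltonian is $H(x,p)=\sup_{v\in F(x)}\langle v,p\rangle$, $x,p\in\mathbb{R}^n$. (SH): (i) $F(x)$ is nonempty, convex, compact for each $x$; (ii) $F$ is locally Lipschitz, i.e. each $x$ has a neighborhood $K$ and a constant $c>0$ with $F(z)\subset F(y)+c|z-y|B(0,1)$ for all $z,y\in K$; (iii) there is $\gamma>0$ with $\max\{|v|:v\in F(x)\}\le\gamma(1+|x|)$ for all $x$. (H): for every $r>0$: (i) there is $c\ge0$ such that for all $p\in S^{n-1}$ (unit sphere) the map $x\mapsto H(x,p)$ is semiconvex on $B(0,r)$ with constant $c$; (ii) $\nabla_pH(x,p)$ exists and is Lipschitz in $x$ on $B(0,r)$, uniformly for $p\in\mathbb{R}^n\setminus\{0\}$. A function $f$ is semiconcave on $\Omega$ (with constant $c$) if it is continuous and $f(x+h)+f(x-h)-2f(x)\le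 c|h|^2$ whenever $[x-h,x+h]\subset\Omega$; $f$ is semiconvex if $-f$ is semiconcave. $B(x,\epsilon)$ is the closed ball. The Fréchet subdifferential of $f$ at $x$ is $\partial^-f(x)=\{p:\liminf_{y\to x}\frac{f(y)-f(x)-\langle p,y-x\rangle}{|y-x|}\ge0\}$; $\partial_x^-H$, $\partial_p^-H$ denote the Fréchet subdifferentials of $H(\cdot,p)$ and $H(x,\cdot)$. The proximal subdifferential $\partial^{-,pr}f(x)$ is the set of $p$ for which there are $c,\rho$ (with $c\ge 0$, $\rho>0$) such that $f(y)-f(x)-\langle p,y-x\rangle\ge-c|y-x|^2$ for all $y\in B(x,\rho)$; $\partial_x^{-,pr}V(t,x)$ is that of $V(t,\cdot)$ at $x$. For $S(n)$ the real symmetric $n\times n$ matrices, the set of subjets $J^{2,-}f(x)$ is the set of $(q,Q)\in\mathbb{R}^n\times S(n)$ such that for some $\delta>0$ and all $y\in B(x,\delta)$, $f(y)\ge f(x)+\langle q,y-x\rangle+\frac12\langle Q(y-x),y-x\rangle+o(|y-x|^2)$; $J_x^{2,-}V(t,x)$ denotes the set of subjets of $V(t,\cdot)$ at $x$. $I_n$ is the identity matrix. *)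

(* Defs.v *)
From HB Require Import structures.
From mathcomp Require Import all_boot all_order all_algebra.
From mathcomp Require Import all_classical all_reals all_analysis.
Import Order.TTheory GRing.Theory Num.Theory.
Import numFieldNormedType.Exports.

Set Implicit Arguments.
Unset Strict Implicit.
Unset Printing Implicit Defensive.

Local Open Scope classical_set_scope.
Local Open Scope ring_scope.

(* R^n is 'rV[R]_n.  The library norm on matrices is the max norm, so the
   Euclidean one is introduced here; nbhs, compact, continuous, differentiable
   and littleo below are the library notions, for which the two equivalent
   norms agree. *)
Section Euclidean.
Context {R : realType} {n : nat}.
Implicit Types (x y u v : 'rV[R]_n) (r : R).

Definition dotp u v : R := \sum_i u 0 i * v 0 i.
Definition enorm v : R := Num.sqrt (dotp v v).
Definition eball x r : set 'rV[R]_n := [set y | enorm (y - x) <= r].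
Definition esphere : set 'rV[R]_n := [set v | enorm v = 1].

End Euclidean.

Section Nonsmooth.
Context {R : realType} {n : nat}.
Local Notation E := 'rV[R]_n.
Implicit Types (f : E -> R) (x p : E) (W : set E).

(* The max norm of the library only changes the Lipschitz constants. *)
Definition locally_lipschitz f :=
  forall x : E, exists2 K : set E, nbhs x K & [lipschitz f y | y in K].

(* The segment [x - h, x + h] is required to lie in W. *)
Definition semiconcave W (c : R) f :=
  {within W, continuous f} /\
  forall x h : E,
    (forall s : R, -1 <= s <= 1 -> W (x + s *: h)) ->
    f (x + h) + f (x - h) - 2 * f x <= c * enorm h ^+ 2.

Definition semiconvex W (c : R) f := semiconcave W c (fun x => - f x).

Definition gradient f x : E := \row_i 'D_(delta_mx 0 i) f x.

Definition frechet_subdiff f x : set E :=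
  [set p | (0 <= limf_einf
      (fun y => ((f y - f x - dotp p (y - x)) / enorm (y - x))%:E) x^')%E].

Definition prox_subdiff f x : set E :=
  [set p | exists c rho : R, [/\ 0 <= c, 0 < rho &
    forall y, eball x rho y ->
      f y - f x - dotp p (y - x) >= - c * enorm (y - x) ^+ 2]].

(* g is the remainder o(|y - x|^2). *)
Definition subjet f x : set (E * 'M[R]_n) :=
  [set qQ | qQ.2^T = qQ.2 /\
    exists (g : E -> R) (delta : R),
      [/\ g =o_ x (fun y => enorm (y - x) ^+ 2), 0 < delta &
      forall y, eball x delta y ->
        f y >= f x + dotp qQ.1 (y - x)
               + 2^-1 * dotp ((y - x) *m qQ.2) (y - x) + g y]].

End Nonsmooth.

Section Mayer.
Context {R : realType} {n : nat}.
Local Notation E := 'rV[R]_n.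

(* Absolute continuity on `[a, b]; only the values of x on `[a, b] matter. *)
Definition is_arc (a b : R) (x : R -> E) :=
  forall e : R, 0 < e -> exists2 d : R, 0 < d &
    forall (m : nat) (u v : 'I_m -> R),
      (forall i, a <= u i /\ u i <= v i /\ v i <= b) ->
      trivIset setT (fun i => `]u i, v i[%classic) ->
      \sum_i (v i - u i) < d ->
      \sum_i enorm (x (v i) - x (u i)) < e.

(* The derivative is two-sided, which is harmless: the endpoints of `[a, b]
   are negligible. *)
Definition ae_derive (a b : R) (x : R -> E) (P : R -> set E) :=
  {ae (@lebesgue_measure R), forall s : R,
    s \in `[a, b] -> derivable x s 1 /\ P s (derive1 x s)}.

Variable T : R.
Variable F : E -> set E.
Variable phi : E -> R.

Definition trajectory (t0 : R) (x0 : E) (x : R -> E) :=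
  [/\ is_arc t0 T x, ae_derive t0 T x (fun s => F (x s)) & x t0 = x0].

Definition optimal (t0 : R) (x0 : E) (x : R -> E) :=
  trajectory t0 x0 x /\
  forall y, trajectory t0 x0 y -> phi (x T) <= phi (y T).

(* inf and sup on R are meaningful only for nonempty sets bounded on the
   relevant side; under (SH), with phi continuous and t0 <= T, this holds for
   value and hamiltonian. *)
Definition value (t0 : R) (x0 : E) : R :=
  inf [set phi (x T) | x in trajectory t0 x0].

Definition hamiltonian (x p : E) : R := sup [set dotp v p | v in F x].

Definition SH_i :=
  forall x : E, [/\ F x !=set0, @convex_set R E (F x) & compact (F x)].

Definition SH_ii :=
  forall x : E, exists (K : set E) (c : R), [/\ nbhs x K, 0 < c &
    forall z y, K z -> K y ->
      F z `<=` [set w + (c * enorm (z - y)) *: u | w in F y & u in eball 0 1]].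

Definition SH_iii :=
  exists2 gamma : R, 0 < gamma &
    forall x v, F x v -> enorm v <= gamma * (1 + enorm x).

Definition SH := [/\ SH_i, SH_ii & SH_iii].

Definition H_i (r : R) :=
  exists2 c : R, 0 <= c &
    forall p, esphere p ->
      semiconvex (eball 0 r) c (fun x => hamiltonian x p).

Definition H_ii (r : R) :=
  (forall x p : E, eball 0 r x -> p != 0 -> differentiable (hamiltonian x) p) /\
  exists2 k : R, 0 <= k &
    forall p : E, p != 0 -> forall x y : E, eball 0 r x -> eball 0 r y ->
      enorm (gradient (hamiltonian x) p - gradient (hamiltonian y) p)
        <= k * enorm (x - y).

Definition H_hyp := forall r : R, 0 < r -> H_i r /\ H_ii r.

End Mayer.

(* Main.v *)
From HB Require Import structures.
Require Import Defs.
From mathcomp Require Import all_boot all_order all_algebra.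
From mathcomp Require Import all_classical all_reals all_analysis.
From mathcomp Require Import ring lra.
Import Order.TTheory GRing.Theory Num.Theory.
Import numFieldNormedType.Exports.

(** Let k be a Lipschitz constant of F and of the maps grad_p H(., p) near the optimal
curve x. The inequality at time t follows from the one at time t0 once every end point
x(t) + h is reached by a solution y of y' in F(y) on [t0, t] such that, with z = y - x,
|z(t0)| <= C|h| and <p(t), h> - <p(t0), z(t0)> >= -C|h|^2. Indeed the value function is
nondecreasing along y and constant along x, so that
V(t, x(t) + h) - V(t, x(t)) >= V(t0, y(t0)) - V(t0, x(t0))
>= <-p(t0), z(t0)> - C|z(t0)|^2 >= <-p(t), h> - C'|h|^2.

To find y, the velocity y' should maximise <., p> over F(y) and stay within k|z| of x'.
For p <> 0 any maximiser does, since it equals grad_p H(y, p); for p = 0 the Lipschitz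
continuity of F is used (gradient_hamiltonian_selection). With such a velocity |z| grows
at most exponentially backwards in time, and
<p, z>' = <p', z> + H(y, p) - H(x, p) >= - c|p||z|^2,
because -p' is a Frechet subgradient of the semiconvex function H(., p)
(frechet_subdiff_hamiltonian_x).

The velocity is only prescribed through the measurable functions x' and p'. Rather than
by a measurable selection, y is obtained as a limit of backward Euler curves on tagged
partitions: mean values of x' over short intervals around s are close to a
maximiser at s (average_velocity_of_ae_derive), increments of p obey the subgradient
inequality at s (average_adjoint_of_ae_derive), and both follow from the estimate that
an absolutely continuous function whose slope is at most M almost everywhere increases
at most with slope M (abs_continuous_le_slope). The width of the intervals on
which these approximations hold depends on s, and it need not be bounded below near the
zeros of p; so partitions are handled through interval_induction, which plays the role
of the existence of partitions that are fine for an arbitrary gauge.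

The Euler curves are equi-Lipschitz and converge pointwise along an ultrafilter
(tracking_curve). That the limit solves the inclusion is stated without derivatives, by
bounding its increments with the support function of F (increments_in). This yields the
inclusion wherever the limit is differentiable, which is almost everywhere because the
Stieltjes measure of a monotone Lipschitz function has a Lebesgue density
(lipschitz_curve_ae_derivable).

The infimum defining V(t, x(t) + h) must also be one over a nonempty set: a solution on
[t, T] starting at x(t) + h is obtained by the same construction for the reversed
inclusion with p = 0 (forward_tracking). *)

Set Implicit Arguments.
Unset Strict Implicit.
Unset Printing Implicit Defensive.

Local Open Scope classical_set_scope.
Local Open Scope ring_scope.

(** * Euclidean norm on row vectors *)

Section EuclideanSpace.
Context {R : realType} {n : nat}.
Local Notation E := 'rV[R]_n.
Implicit Types (u v w x : E) (a r : R).

Lemma dotpC u v : dotp u v = dotp v u.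
Proof. by rewrite /dotp; apply: eq_bigr => i _; rewrite mulrC. Qed.

Lemma dotpDl u v w : dotp (u + v) w = dotp u w + dotp v w.
Proof.
by rewrite /dotp -big_split; apply: eq_bigr => i _; rewrite mxE mulrDl.
Qed.

Lemma dotpZl a u v : dotp (a *: u) v = a * dotp u v.
Proof. by rewrite /dotp mulr_sumr; apply: eq_bigr => i _; rewrite mxE mulrA. Qed.

Lemma dotpNl u v : dotp (- u) v = - dotp u v.
Proof. by rewrite -scaleN1r dotpZl mulN1r. Qed.

Lemma dotpBl u v w : dotp (u - v) w = dotp u w - dotp v w.
Proof. by rewrite dotpDl dotpNl. Qed.

Lemma dotp0l v : dotp 0 v = 0.
Proof. by rewrite -(scale0r (0 : E)) dotpZl mul0r. Qed.

Lemma dotpDr u v w : dotp w (u + v) = dotp w u + dotp w v.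
Proof. by rewrite dotpC dotpDl !(dotpC w). Qed.

Lemma dotpZr a u v : dotp v (a *: u) = a * dotp v u.
Proof. by rewrite dotpC dotpZl (dotpC v). Qed.

Lemma dotpNr u v : dotp v (- u) = - dotp v u.
Proof. by rewrite dotpC dotpNl (dotpC v). Qed.

Lemma dotpBr u v w : dotp w (u - v) = dotp w u - dotp w v.
Proof. by rewrite dotpDr dotpNr. Qed.

Lemma dotp0r v : dotp v 0 = 0.
Proof. by rewrite dotpC dotp0l. Qed.

Definition dotpE := (dotpDl, dotpDr, dotpNl, dotpNr, dotpZl, dotpZr).

Lemma dotpvv_ge0 v : 0 <= dotp v v.
Proof. by apply: sumr_ge0 => i _; rewrite -expr2 sqr_ge0. Qed.

Lemma enorm_ge0 v : 0 <= enorm v.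
Proof. exact: sqrtr_ge0. Qed.

Lemma enorm_sqr v : enorm v ^+ 2 = dotp v v.
Proof. by rewrite sqr_sqrtr // dotpvv_ge0. Qed.

Lemma dotp_delta v i : dotp v (delta_mx 0 i) = v 0 i.
Proof.
rewrite /dotp (bigD1 i) //= big1 ?addr0; first by rewrite mxE !eqxx mulr1.
by move=> j ji; rewrite mxE (negPf ji) mulr0.
Qed.

Lemma normr_coord_enorm v i : `|v 0 i| <= enorm v.
Proof.
rewrite -(@ler_pXn2r _ 2) ?nnegrE ?enorm_ge0 // enorm_sqr real_normK ?num_real //.
rewrite /dotp (bigD1 i) //= -expr2 lerDl.
by apply: sumr_ge0 => j _; rewrite -expr2 sqr_ge0.
Qed.

Lemma enorm0_eq0 v : enorm v = 0 -> v = 0.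
Proof.
move=> v0; apply/rowP => i; rewrite mxE; apply/eqP; rewrite -normr_le0.
by rewrite (le_trans (normr_coord_enorm v i)) // v0.
Qed.

Lemma enorm0 : enorm (0 : E) = 0.
Proof. by rewrite /enorm dotp0l sqrtr0. Qed.

Lemma enorm_gt0 v : v != 0 -> 0 < enorm v.
Proof.
move=> v0; rewrite lt_neqAle enorm_ge0 andbT eq_sym; apply/eqP => /enorm0_eq0 /eqP.
by rewrite (negPf v0).
Qed.

Lemma enormZ a v : enorm (a *: v) = `|a| * enorm v.
Proof.
by rewrite /enorm dotpZl dotpZr mulrA -expr2 sqrtrM ?sqr_ge0 // sqrtr_sqr.
Qed.

Lemma enormN v : enorm (- v) = enorm v.
Proof. by rewrite -scaleN1r enormZ normrN1 mul1r. Qed.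

Lemma enormBC u v : enorm (u - v) = enorm (v - u).
Proof. by rewrite -enormN opprB. Qed.

(** Cauchy-Schwarz: expand the square of |v|u - |u|v. *)
Lemma dotp_le u v : dotp u v <= enorm u * enorm v.
Proof.
have [->|u0] := eqVneq u 0; first by rewrite dotp0l enorm0 mul0r.
have [->|v0] := eqVneq v 0; first by rewrite dotp0r enorm0 mulr0.
have := dotpvv_ge0 (enorm v *: u - enorm u *: v).
rewrite !dotpE -!enorm_sqr (dotpC v u).
have := enorm_gt0 u0; have := enorm_gt0 v0.
set a := enorm u; set b := enorm v; set d := dotp u v => b0 a0 H.
have ab : 0 < a * b by rewrite mulr_gt0.
rewrite -subr_ge0 -(pmulr_rge0 _ ab); nra.
Qed.

Lemma normr_dotp_le u v : `|dotp u v| <= enorm u * enorm v.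
Proof.
rewrite ler_norml dotp_le andbT lerNl -dotpNl.
by rewrite (le_trans (dotp_le _ _)) // enormN.
Qed.

Lemma dotp_ge u v : - (enorm u * enorm v) <= dotp u v.
Proof. by have := normr_dotp_le u v; rewrite ler_norml => /andP[]. Qed.

Lemma enorm_triangle u v : enorm (u + v) <= enorm u + enorm v.
Proof.
rewrite -(@ler_pXn2r _ 2) ?nnegrE ?addr_ge0 ?enorm_ge0 // enorm_sqr.
rewrite !dotpE sqrrD !enorm_sqr (dotpC v u).
by have := dotp_le u v; lra.
Qed.

Lemma enorm_triangleB w u v : enorm (u - v) <= enorm (u - w) + enorm (w - v).
Proof. by rewrite (le_trans _ (enorm_triangle _ _)) // addrA subrK. Qed.

Lemma normr_coord_le v i : `|v 0 i| <= `|v|.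
Proof.
rewrite [leRHS]mx_normE.
by rewrite -[leLHS]nngE num_le (le_bigmax _ (fun ij => `|v ij.1 ij.2|%:nng) (0, i)).
Qed.

Lemma enorm_le_norm : exists2 C : R, 0 < C & forall v, enorm v <= C * `|v|.
Proof.
exists (n%:R + 1); first by rewrite ltr_wpDl.
move=> v; rewrite -(@ler_pXn2r _ 2) ?nnegrE ?enorm_ge0 ?mulr_ge0 ?addr_ge0 //.
rewrite enorm_sqr exprMn.
have vi i : v 0 i ^+ 2 <= `|v| ^+ 2.
  rewrite -real_normK ?num_real // ler_pXn2r ?nnegrE //.
  exact: normr_coord_le.
have : dotp v v <= n%:R * `|v| ^+ 2.
  apply: (le_trans (ler_sum _ (fun i _ => _ : v 0 i * v 0 i <= `|v| ^+ 2))).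
    by move=> i _; rewrite -expr2.
  by rewrite sumr_const card_ord mulr_natl.
move=> /le_trans; apply; apply: ler_wpM2r; first exact: sqr_ge0.
have : 0 <= n%:R :> R by []. nra.
Qed.

End EuclideanSpace.

(** * Euclidean topology and projection on convex sets *)

Section EuclideanTopology.
Context {R : realType} {n : nat}.
Local Notation E := 'rV[R]_n.
Implicit Types (u v w x : E) (a r : R).

Lemma norm_le_enorm v : `|v| <= enorm v.
Proof.
rewrite [leLHS]mx_normrE; apply/bigmax_leP; split; first exact: enorm_ge0.
by move=> [i j] _ /=; rewrite (ord1 i); exact: normr_coord_enorm.
Qed.

Lemma nbhs_eballP x (A : set E) :
  nbhs x A <-> exists2 r : R, 0 < r & eball x r `<=` A.
Proof.
split.
- move=> /nbhs_ballP[r /= r0 rA]; exists (r / 2); first by rewrite divr_gt0.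
  move=> y /= yx; apply: rA; rewrite -ball_normE /= distrC.
  by rewrite (le_lt_trans (norm_le_enorm _)) // (le_lt_trans yx) // ltr_pdivrMr //; lra.
- move=> [r r0 rA]; have [C C0 CP] := @enorm_le_norm R n.
  apply/nbhs_ballP; exists (r / C) => /=; first by rewrite divr_gt0.
  move=> y; rewrite -ball_normE /= distrC => yx; apply: rA.
  by rewrite /eball /= (le_trans (CP _)) // mulrC -ler_pdivlMr // ltW.
Qed.

Lemma dotp_continuous u : continuous (dotp u : E -> R).
Proof.
move=> v; apply/(cvgrPdist_le (F := nbhs v) (FF := nbhs_filter v)) => e e0.
have nv : \forall w \near v, eball v (e / (enorm u + 1)) w.
  apply/nbhs_eballP; exists (e / (enorm u + 1)) => //.
  by rewrite divr_gt0 // ltr_wpDl ?enorm_ge0.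
apply: (@filterS _ (nbhs v) (nbhs_filter v) _ _ _ nv) => w.
rewrite /eball /= enormBC ler_pdivlMr ?ltr_wpDl ?enorm_ge0 // => wv.
rewrite -dotpBr (le_trans (normr_dotp_le _ _)) // (le_trans _ wv) // mulrC.
by rewrite ler_wpM2l ?enorm_ge0 // lerDl.
Qed.

Lemma enormB_continuous u : continuous (fun v : E => enorm (v - u)).
Proof.
move=> v; apply/(cvgrPdist_le (F := nbhs v) (FF := nbhs_filter v)) => e e0.
have nv : \forall w \near v, eball v e w by apply/nbhs_eballP; exists e.
apply: (@filterS _ (nbhs v) (nbhs_filter v) _ _ _ nv) => w.
rewrite /eball /= => wv; rewrite ler_norml.
have := enorm_triangleB w v u; have := enorm_triangleB v w u.
by rewrite (enormBC v w); lra.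
Qed.

Lemma eball_compact x r : compact (eball x r : set E).
Proof.
apply: bounded_closed_compact.
- exists (`|x| + r); split => [|M xM y]; first exact: num_real.
  rewrite /eball /= => yx.
  rewrite (le_trans _ (ltW xM)) // -[y](subrK x) (le_trans (ler_normD _ _)) //.
  by rewrite addrC lerD2l (le_trans (norm_le_enorm _)).
- rewrite (_ : eball x r = (fun v : E => enorm (v - x)) @^-1` [set s | s <= r]) //.
  by apply: preimage_closed; [move=> v _; exact: enormB_continuous|exact: closed_le].
Qed.

End EuclideanTopology.

Section ConvexSets.
Context {R : realType} {n : nat}.
Local Notation E := 'rV[R]_n.
Implicit Types (K : set E) (u v w x : E).

Lemma convex_setP K a b (l : R) : @convex_set R E K -> K a -> K b ->
  0 <= l -> l <= 1 -> K (l *: a + (1 - l) *: b).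
Proof.
move=> cK Ka Kb l0 l1.
have l01 : Itv.spec (@Itv.num_sem R) (Itv.Real `[0%Z, 1%Z]) l.
  by rewrite /= /Itv.num_sem /= num_real /= in_itv /= l0.
by have := cK a b (Itv.mk l01); rewrite !inE; apply.
Qed.

(** The nearest point of K is characterised by a variational inequality: moving
from u towards a point a of K cannot decrease the distance to first order. *)
Lemma projection_convex K v : K !=set0 -> @convex_set R E K -> compact K ->
  exists2 u, K u & forall a, K a -> dotp (a - u) (v - u) <= 0.
Proof.
move=> K0 cK coK.
have [u /[!inE] Ku umin] := compact_EVT_min K0 coK
  (continuous_subspaceT (@enormB_continuous R n v)).
exists u => // a Ka; rewrite leNgt; apply/negP => gt0.
set s := dotp (a - u) (v - u) in gt0.
set q := dotp (a - u) (a - u).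
have q0 : 0 <= q := dotpvv_ge0 _.
(* A step l for which the linear gain 2ls beats the quadratic loss l^2 q. *)
pose l := s / (s + q).
have sq0 : 0 < s + q by rewrite ltr_wpDr.
have l0 : 0 < l by rewrite divr_gt0.
have l1 : l <= 1 by rewrite ler_pdivrMr // mul1r lerDl.
have lsq : l * (s + q) = s by rewrite mulfVK // gt_eqF.
have Kl := convex_setP cK Ka Ku (ltW l0) l1.
have := umin _ (mem_set Kl).
rewrite -(@ler_pXn2r _ 2) ?nnegrE ?enorm_ge0 // !enorm_sqr.
have -> : l *: a + (1 - l) *: u - v = l *: (a - u) - (v - u).
  by rewrite scalerBl scale1r scalerBr opprB !addrA addrAC.
rewrite -(opprB v u) dotpNl dotpNr opprK (dotpBl (l *: _)) !(dotpBr _ (v - u)).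
rewrite !(dotpZl, dotpZr) (dotpC (v - u) (a - u)) -/s -/q.
have := dotpvv_ge0 (v - u).
set d := dotp (v - u) (v - u) => d0 H.
have : 0 <= l * (l * q - 2 * s) by lra.
rewrite pmulr_rge0 //.
have : 0 <= l * s by rewrite mulr_ge0 // ltW.
nra.
Qed.

End ConvexSets.

(** * Interval induction and absolutely continuous functions *)

Section IntervalInduction.
Context {R : realType}.

(** A continuous induction along an interval, run from right to left.  The radius
d may depend on s in an uncontrolled way; the statement plays the role of the
existence of a tagged partition of [a, b] that is fine for an arbitrary gauge. *)
Lemma interval_induction (a b : R) (Q : R -> Prop) : a <= b -> Q b ->
  (forall s, a <= s <= b -> exists2 d : R, 0 < d & forall c e : R,
     a <= c -> c <= s -> s <= e -> e <= b -> s - d < c -> e < s + d ->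
     Q e -> Q c) ->
  Q a.
Proof.
move=> ab Qb step; pose S := [set c | a <= c <= b /\ Q c].
have Sb : S b by split => //; rewrite ab lexx.
have Slb : lbound S a by move=> c [/andP[]].
have Sinf : has_inf S by split; [exists b|exists a].
pose m := inf S.
have am : a <= m by apply: lb_le_inf => //; exists b.
have mb : m <= b by apply: ge_inf => //; exists a.
have [|d d0 dP] := step m; first by rewrite am mb.
have [e [/andP[ae eb] Qe] eltm] := inf_adherent d0 Sinf.
have me : m <= e by apply: ge_inf; [exists a|split => //; rewrite ae eb].
pose c := Num.max a (m - d / 2).
have cm : c <= m by rewrite ge_max am; lra.
have mdc : m - d < c by rewrite lt_max; apply/orP; right; lra.
have Qc : Q c by apply: (dP c e) => //; rewrite le_max lexx.
have mc : m <= c.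
  apply: ge_inf; first by exists a.
  by split => //; rewrite le_max lexx /= (le_trans cm mb).
move: mc Qc; rewrite /c le_max => /orP[ma|]; last lra.
by rewrite max_l //; lra.
Qed.

End IntervalInduction.

Section AbsoluteContinuity.
Context {R : realType}.
Local Notation mu := (@lebesgue_measure R).

Definition abs_continuous (a b : R) (g : R -> R) :=
  forall e : R, 0 < e -> exists2 d : R, 0 < d &
    forall (m : nat) (u v : 'I_m -> R),
      (forall i, a <= u i /\ u i <= v i /\ v i <= b) ->
      trivIset setT (fun i => `]u i, v i[%classic) ->
      \sum_i (v i - u i) < d ->
      \sum_i `|g (v i) - g (u i)| < e.

Lemma negligible_open_cover (N : set R) (d : R) : mu.-negligible N -> 0 < d ->
  exists U : set R, [/\ open U, N `<=` U & (mu U < d%:E)%E].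
Proof.
move=> [A [mA A0 NA]] d0.
have [|U [oU AU Ud]] := @lebesgue_regularity_outer R A d mA _ d0.
  exact: (eq_ind_r (fun z => (z < +oo)%E) (ltry 0) A0).
exists U; split => //; first exact: subset_trans NA AU.
rewrite -(setDUK AU); apply: (@le_lt_trans _ _ (mu A + mu (U `\` A))%E).
  exact: outer_measureU2.
by rewrite A0 add0e.
Qed.

(** A one-sided derivative bound in terms of intervals that contain s, not only of those
that end at s: this is the form that sums up over tagged partitions. *)
Definition upper_straddle (g : R -> R) (s M : R) :=
  forall e : R, 0 < e -> exists2 d : R, 0 < d & forall c t : R,
    c <= s -> s <= t -> s - d < c -> t < s + d ->
    g t - g c <= (M + e) * (t - c).

(** The exceptional null set is covered by an open set of measure less than a
prescribed d.  In a fine tagged partition the intervals tagged outside of the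
null set contribute the slope M, and those tagged in it form a family of disjoint
intervals of total length less than d, which absolute continuity neglects. *)
Lemma abs_continuous_le_slope (a b M : R) (g : R -> R) : a <= b ->
  abs_continuous a b g ->
  {ae mu, forall s, s \in `[a, b] -> upper_straddle g s M} ->
  g b - g a <= M * (b - a).
Proof.
move=> ab gac gM; apply/ler_addgt0Pr => e0 e0_gt0.
pose e := e0 / (b - a + 2).
have ba2 : 0 < b - a + 2 by lra.
have e_gt0 : 0 < e by rewrite divr_gt0.
have [d1 d1_gt0 d1P] := gac _ e_gt0.
pose d := Num.min d1 (e / (`|M + e| + 1)).
have d_gt0 : 0 < d by rewrite lt_min d1_gt0 divr_gt0 // ltr_wpDl.
have [U [oU NU Ud]] := negligible_open_cover gM d_gt0.
(* Q c: from c to b the increment is at most that of slope M + e outside of a finite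
   family of disjoint subintervals of U, plus the increments over this family. *)
pose Q c := exists (m : nat) (u v : 'I_m -> R),
  [/\ forall i, c <= u i /\ u i <= v i /\ v i <= b,
      trivIset setT (fun i => `]u i, v i[%classic),
      ((\sum_i (v i - u i))%:E <= mu (U `&` `]c, b[))%E &
      g b - g c <= (M + e) * (b - c - \sum_i (v i - u i))
                   + \sum_i `|g (v i) - g (u i)|].
have : Q a.
  apply: (interval_induction ab).
    exists 0, (fun=> 0), (fun=> 0); split.
    - by case.
    - by move=> [].
    - by rewrite big_ord0.
    - by rewrite !big_ord0 !subrr mulr0 addr0.
  move=> s /andP[sa sb].
  have [sg|sN] := pselect (upper_straddle g s M).
  - have [dl dl_gt0 dlP] := sg _ e_gt0.
    exists dl => // c t ac cs st tb sdc tsd [m [u [v [H1 H2 H3 H4]]]].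
    exists m, u, v; split => //.
    + by move=> i; have [h1 h2] := H1 i; split => //; lra.
    + apply: (le_trans H3); apply: le_measure; rewrite ?inE //.
      * by apply: measurableI; [exact: measurable_realfun.open_measurable|exact: measurable_itv].
      * by apply: measurableI; [exact: measurable_realfun.open_measurable|exact: measurable_itv].
      * move=> x [Ux]; rewrite /= !in_itv /= => /andP[tx xb]; split => //.
        by apply/andP; split => //; lra.
    + have := dlP c t cs st sdc tsd.
      by move: H4; lra.
  - have /NU Us : (~` [set s | s \in `[a, b] -> upper_straddle g s M]) s.
      by move=> /= H; apply: sN; apply: H; rewrite in_itv /= sa sb.
    have [dl /= dl_gt0 dlP] := (nbhs_ballP _ _).1 (open_nbhs_nbhs (conj oU Us)).
    exists dl => // c t ac cs st tb sdc tsd [m [u [v [H1 H2 H3 H4]]]].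
    (* The tag is exceptional: the interval ]c, t[ joins the family. *)
    have ctU : `]c, t[ `<=` U.
      move=> x; rewrite /= in_itv /= => /andP[cx xt]; apply: dlP.
      by rewrite /ball /= ltr_norml; apply/andP; split; lra.
    pose ext (w : R) (f : 'I_m -> R) (i : 'I_m.+1) :=
      if unlift ord0 i is Some j then f j else w.
    have ext0 w f : ext w f ord0 = w by rewrite /ext unlift_none.
    have extS w f j : ext w f (lift ord0 j) = f j by rewrite /ext liftK.
    exists m.+1, (ext c u), (ext t v); split.
    + move=> i; case: (unliftP ord0 i) => [j|] ->; rewrite ?extS ?ext0.
        by have [h1 h2] := H1 j; split => //; lra.
      by lra.
    + move=> i j _ _ [x []] /=.
      case: (unliftP ord0 i) => [i'|] ->; case: (unliftP ord0 j) => [j'|] ->;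
        rewrite ?extS ?ext0 //= => xi xj.
      * by congr lift; apply: H2 => //; exists x.
      * have [h1 h2] := H1 i'; move: xi xj; rewrite !in_itv /=.
        by move=> /andP[? ?] /andP[? ?]; exfalso; lra.
      * have [h1 h2] := H1 j'; move: xi xj; rewrite !in_itv /=.
        by move=> /andP[? ?] /andP[? ?]; exfalso; lra.
    + rewrite big_ord_recl !ext0 EFinD.
      under eq_bigr do rewrite !extS.
      apply: (@le_trans _ _ (mu `]c, t[%classic + mu (U `&` `]t, b[%classic))%E).
        apply: leeD => //; rewrite lebesgue_measure_itv /= lte_fin.
        by case: ltP => // tc; rewrite lee_fin; lra.
      have mi : measurable (`]c, t[%classic : set R) by exact: measurable_itv.
      have mUi p q : measurable (U `&` `]p, q[%classic).
        apply: measurableI; last exact: measurable_itv.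
        exact: measurable_realfun.open_measurable.
      have dis : `]c, t[%classic `&` (U `&` `]t, b[%classic) = set0 :> set R.
        rewrite -subset0 => x [] /=; rewrite !in_itv /= => /andP[_ xt].
        by move=> [_ /andP[tx _]]; lra.
      have <- : mu (`]c, t[%classic `|` (U `&` `]t, b[%classic))
          = (mu `]c, t[%classic + mu (U `&` `]t, b[%classic))%E.
        by apply: measureU => //; exact: mUi.
      apply: le_measure; rewrite ?inE; [by apply: measurableU => //; exact: mUi|exact: mUi|].
      * move=> x /= [xct|[Ux]].
          split; first exact: ctU.
          by move: xct; rewrite /= !in_itv /= => /andP[? ?]; apply/andP; split; lra.
        by rewrite !in_itv /= => /andP[? ?]; split => //; apply/andP; split; lra.
    + rewrite !big_ord_recl !ext0.
      under eq_bigr do rewrite !extS.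
      under [X in _ + (_ + X)]eq_bigr do rewrite !extS.
      have := ler_norm (g t - g c).
      by move: H4; lra.
move=> [m [u [v [H1 H2 H3 H4]]]].
have Sd : \sum_i (v i - u i) < d.
  rewrite -lte_fin (le_lt_trans H3) // (le_lt_trans _ Ud) // le_measure ?inE //.
    by apply: measurableI; [exact: measurable_realfun.open_measurable|exact: measurable_itv].
  exact: measurable_realfun.open_measurable.
have S0 : 0 <= \sum_i (v i - u i).
  by apply: sumr_ge0 => i _; have [_ [h _]] := H1 i; rewrite subr_ge0.
have : \sum_i `|g (v i) - g (u i)| < e.
  by apply: d1P => //; rewrite (lt_le_trans Sd) // ge_min lexx.
have : - (M + e) * \sum_i (v i - u i) <= e.
  rewrite (le_trans (ler_norm _)) // normrM normrN (ger0_norm S0).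
  have : \sum_i (v i - u i) <= e / (`|M + e| + 1).
    by rewrite (le_trans (ltW Sd)) // ge_min lexx orbT.
  by rewrite ler_pdivlMr ?ltr_wpDl // mulrDr mulr1 mulrC; lra.
have : e * (b - a + 2) = e0 by rewrite mulfVK // gt_eqF.
by move: H4; lra.
Qed.

End AbsoluteContinuity.

(** * Almost everywhere differentiability of Lipschitz curves *)

Section LipschitzDerivable.
Context {R : realType}.
Local Notation mu := (@lebesgue_measure R).

Lemma ae_mono (P Q : R -> Prop) :
  {ae mu, forall s, P s} -> (forall s, P s -> Q s) -> {ae mu, forall s, Q s}.
Proof.
move=> aeP PQ; apply: filterS aeP; first exact: (ae_filter_ringOfSetsType mu).
exact: PQ.
Qed.

Lemma ae_and (P Q : R -> Prop) :
  {ae mu, forall s, P s} -> {ae mu, forall s, Q s} ->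
  {ae mu, forall s, P s /\ Q s}.
Proof.
move=> aeP aeQ; apply: filterS2 aeP aeQ; last by move=> s; split.
exact: (ae_filter_ringOfSetsType mu).
Qed.

Lemma lebesgue_stieltjes_itv (f : cumulative R R) (x y : R) : x <= y ->
  lebesgue_stieltjes_measure f `]x, y]%classic = (f y - f x)%:E.
Proof.
move=> xy; rewrite /lebesgue_stieltjes_measure /measure_extension.
rewrite measurable_mu_extE /=; last exact: is_ocitv.
by rewrite wlength_itv_bnd.
Qed.

Lemma lipschitz_continuous (L : R) (f : R -> R) : 0 < L ->
  (forall s t, `|f t - f s| <= L * `|t - s|) -> continuous f.
Proof.
move=> L0 fL s; apply/cvgrPdist_le => e e0.
near=> t; rewrite distrC (le_trans (fL _ _)) // -ler_pdivlMl // mulrC distrC.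
by near: t; apply: cvgr_dist_le => //; rewrite divr_gt0.
Unshelve. all: by end_near. Qed.

(** If f and x - f x are both nondecreasing, then the Stieltjes measures of the two
functions sum up to the Lebesgue measure.  So the measure of f is absolutely
continuous, and f is a primitive of its Radon-Nikodym density. *)
Lemma nondecreasing_lipschitz_ae_derivable (f : R -> R) (a b : R) : a <= b ->
  (forall s t, s <= t -> 0 <= f t - f s <= t - s) ->
  {ae mu, forall s, s \in `]a, b[ -> derivable f s 1}.
Proof.
move=> ab fP; pose f2 s := s - f s.
have f1_nd : {homo f : s t / s <= t}.
  by move=> s t /fP /andP[h _]; rewrite -subr_ge0.
have f2_nd : {homo f2 : s t / s <= t}.
  by move=> s t /fP /andP[_ h]; rewrite /f2; lra.
have f1_c : continuous f.
  apply: (@lipschitz_continuous 1) => // s t.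
  have [st|/ltW ts] := leP s t.
    have /andP[h1 h2] := fP _ _ st.
    by rewrite mul1r ger0_norm // ger0_norm // subr_ge0.
  have /andP[h1 h2] := fP _ _ ts.
  by rewrite mul1r distrC ger0_norm // distrC ger0_norm // subr_ge0.
have f2_c : continuous f2.
  by move=> s; apply: cvgB; [exact: cvg_id|exact: f1_c].
pose F1 : cumulative R R := HB.pack f
  (@isCumulative.Build R _ R f f1_nd (right_continuousW f1_c)).
pose F2 : cumulative R R := HB.pack f2
  (@isCumulative.Build R _ R f2 f2_nd (right_continuousW f2_c)).
pose m1 := lebesgue_stieltjes_measure F1.
pose m2 := lebesgue_stieltjes_measure F2.
have mE A : measurable A -> mu A = measure_add m1 m2 A.
  apply: lebesgue_measure_unique => X /ocitvP[->|[[x y] /= xy ->]].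
    by rewrite !measure0.
  rewrite [RHS]measure_addE; have xy' := ltW xy.
  rewrite [LHS](lebesgue_stieltjes_itv _ xy') [X in (X + _)%E](lebesgue_stieltjes_itv F1 xy').
  rewrite [X in (_ + X)%E](lebesgue_stieltjes_itv F2 xy') -EFinD /=.
  by congr EFin; rewrite /f2; lra.
pose D : set R := `]a, b]%classic.
have mD : measurable (D : set (measurableTypeR R)) by exact: measurable_itv.
have m1D : (m1 D < +oo)%E by rewrite /m1 [X in (X < _)%E](lebesgue_stieltjes_itv F1 ab) ltry.
pose nu : {finite_measure set (measurableTypeR R) -> \bar R} := mfrestr mD m1D.
have nu_mu : nu `<< mu.
  apply/null_content_dominatesP => A mA A0.
  have : (m1 (A `&` D) <= mu A)%E.
    rewrite mE // [leRHS]measure_addE (@le_trans _ _ (m1 A)) ?leeDl //.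
    by apply: le_measure; rewrite ?inE //; exact: measurableI.
  rewrite A0 => h; apply/eqP; rewrite eq_le measure_ge0 andbT.
  exact: h.
have [g [g_ge0 g_fin g_int gE]] := radon_nikodym_sigma_finite nu_mu.
pose h := fine \o g.
have hE : EFin \o h = g by apply/funext => x /=; rewrite fineK.
have h_int : mu.-integrable setT (EFin \o h) by rewrite hE.
have h_loc : locally_integrable setT h.
  by apply: open_integrable_locally => //; exact: openT.
have h_inty (y : R) : mu.-integrable `]-oo, y] (EFin \o h).
  by apply: integrableS h_int => //; exact: measurable_itv.
have FTC := FTC1Ny h_inty h_loc.
apply: (ae_mono FTC) => s [ds _] /= sab.
pose F y := (\int[mu]_(t in [set` `]-oo, y]]) (h t))%R.
have FE y : a <= y <= b -> F y = f y - f a.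
  move=> /andP[ay yb]; rewrite /F /Rintegral.
  under eq_integral do rewrite /h /= fineK //.
  rewrite -gE; last exact: measurable_itv.
  rewrite /nu /= /mfrestr /mrestr (_ : _ `&` D = `]a, y]%classic).
    by rewrite [X in fine X](lebesgue_stieltjes_itv F1 ay).
  apply/seteqP; split => x; rewrite /D /= !in_itv /=.
    by move=> [-> /andP[-> _]].
  by move=> /andP[ax xy]; split => //; rewrite ax (le_trans xy yb).
have nearF : \forall y \near s, F y + f a = f y.
  have near_s : \forall y \near s, y \in `]a, b[ by exact: near_in_itvoo.
  apply: filterS near_s => y; rewrite in_itv /= => /andP[ay yb].
  by rewrite FE ?subrK // !ltW.
by apply: (near_eq_derivable nearF); apply: derivableD.
Unshelve. all: by end_near. Qed.

Lemma lipschitz_ae_derivable (g : R -> R) (a b L : R) : a <= b -> 0 < L ->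
  (forall s t, a <= s -> s <= t -> t <= b -> `|g t - g s| <= L * (t - s)) ->
  {ae mu, forall s, s \in `]a, b[ -> derivable g s 1}.
Proof.
move=> ab L0 gL.
(* Clamping extends g by constants; adding L s makes it nondecreasing, and the factor
   1 / (2L) makes it 1-Lipschitz. *)
pose cl s := Num.max a (Num.min s b).
have cl_in s : a <= cl s <= b by rewrite /cl le_max lexx ge_max ab ge_min lexx orbT.
have cl_id s : a <= s <= b -> cl s = s.
  by move=> /andP[sa sb]; rewrite /cl min_l // max_r.
have cl_le s t : s <= t -> 0 <= cl t - cl s <= t - s.
  move=> st; rewrite /cl /Num.max /Num.min.
  by case: (ltP s b) => ?; case: (ltP t b) => ?; do 2 (case: ltP => ?);
    apply/andP; split; lra.
pose f s := (g (cl s) + L * cl s) / (2 * L).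
have fP s t : s <= t -> 0 <= f t - f s <= t - s.
  move=> st; have /andP[c0 c1] := cl_le _ _ st.
  have /andP[as_ _] := cl_in s; have /andP[_ tb] := cl_in t.
  have : `|g (cl t) - g (cl s)| <= L * (cl t - cl s).
    by apply: gL => //; rewrite -subr_ge0.
  rewrite ler_norml => /andP[h1 h2].
  have -> : f t - f s = (g (cl t) - g (cl s) + L * (cl t - cl s)) / (2 * L).
    by rewrite /f -mulrBl; congr (_ / _); lra.
  have L2 : 0 < 2 * L by lra.
  apply/andP; split; first by apply: divr_ge0; lra.
  rewrite ler_pdivrMr //.
  have : L * (cl t - cl s) <= L * (t - s) by rewrite ler_pM2l.
  by lra.
apply: (ae_mono (nondecreasing_lipschitz_ae_derivable ab fP)) => s df sab.
pose g' := (2 * L) \*: f - L \*: (@id R).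
have nearg : \forall t \near s, g' t = g t.
  have near_s : \forall t \near s, t \in `]a, b[ by exact: near_in_itvoo.
  apply: filterS near_s => t; rewrite in_itv /= => /andP[at_ tb].
  have -> : g' t = 2 * L * f t - L * t by [].
  rewrite /f cl_id ?ltW // mulrCA mulfV ?mulr1 ?addrK //.
  by rewrite mulf_neq0 // gt_eqF.
apply: (near_eq_derivable nearg); apply: derivableB.
  by apply: derivableZ; exact: df.
by apply: derivableZ; exact: derivable_id.
Unshelve. all: by end_near. Qed.

Lemma ae_forall_ord (n : nat) (P : 'I_n -> R -> Prop) :
  (forall i, {ae mu, forall s, P i s}) -> {ae mu, forall s, forall i, P i s}.
Proof.
move=> aeP.
by apply: (@filter_forall R 'I_n P (almost_everywhere mu) (ae_filter_ringOfSetsType mu)).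
Qed.

Lemma ae_neq (a : R) : {ae mu, forall s, s != a}.
Proof.
exists [set a]; split; [exact: measurable_set1|exact: lebesgue_measure_set1|].
by move=> s /= /negP; rewrite negbK => /eqP.
Qed.

Lemma lipschitz_curve_ae_derivable (n : nat) (y : R -> 'rV[R]_n) (a b L : R) :
  a <= b -> 0 < L ->
  (forall s t, a <= s -> s <= t -> t <= b -> enorm (y t - y s) <= L * (t - s)) ->
  {ae mu, forall s, s \in `[a, b] -> derivable y s 1}.
Proof.
move=> ab L0 yL.
have coord i : {ae mu, forall s, s \in `]a, b[ -> derivable (fun t => y t 0 i) s 1}.
  apply: (@lipschitz_ae_derivable _ _ _ L) => // s t as_ st tb.
  rewrite (le_trans _ (yL _ _ as_ st tb)) //.
  by have := normr_coord_enorm (y t - y s) i; rewrite !mxE.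
have := ae_and (ae_and (ae_neq a) (ae_neq b)) (ae_forall_ord coord).
move=> /ae_mono; apply => s [[sa sb] ds]; rewrite in_itv /= => /andP[as_ sb'].
apply/derivable_mxP => i j; rewrite (ord1 i); apply: ds.
by rewrite in_itv /= !lt_neqAle as_ sb' eq_sym sa sb.
Qed.

End LipschitzDerivable.

(** * Frechet subgradients of semiconvex functions *)

Section FrechetSubdifferential.
Context {R : realType} {n : nat}.
Local Notation E := 'rV[R]_n.
Implicit Types (f : E -> R) (x p q z : E).

Lemma frechet_subdiff_near f x q (e : R) : frechet_subdiff f x q -> 0 < e ->
  exists2 r : R, 0 < r & forall y, eball x r y ->
    - e * enorm (y - x) <= f y - f x - dotp q (y - x).
Proof.
rewrite /frechet_subdiff /= limf_einfE => h e0.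
have : ((- e)%:E < ereal_sup [set ereal_inf
    ((fun y => ((f y - f x - dotp q (y - x)) / enorm (y - x))%:E) @` V) |
    V in x^'])%E by rewrite (lt_le_trans _ h) // lte_fin oppr_lt0.
move=> /ereal_sup_gt[_ [V Vx <-] eV].
have [r r0 rV] := (nbhs_eballP _ _).1 Vx.
exists r => // y yx; have [->|yNx] := eqVneq y x.
  by rewrite !subrr enorm0 dotp0r mulr0 subr0.
rewrite -ler_pdivlMr ?enorm_gt0 ?subr_eq0 // -lee_fin (le_trans (ltW eV)) //.
by apply: ereal_inf_lbound; exists y => //; exact: rV.
Qed.

(** Halving the increment repeatedly costs at most c|z|^2 in total (a geometric
series), and turns the increment into an infinitesimal one. *)
Lemma frechet_subdiff_semiconvex f x q z (c : R) : frechet_subdiff f x q ->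
  (forall t : R, 0 < t -> t <= 1 -> - c * (t / 2 * enorm z) ^+ 2 <=
     f (x + t *: z) + f x - 2 * f (x + (t / 2) *: z)) ->
  0 <= c ->
  - c * enorm z ^+ 2 <= f (x + z) - f x - dotp q z.
Proof.
move=> fq mid c0.
pose g t := f (x + t *: z) - f x - t * dotp q z.
have gz : g 1 = f (x + z) - f x - dotp q z by rewrite /g scale1r mul1r.
rewrite -gz.
set D := c * enorm z ^+ 2.
have D0 : 0 <= D by rewrite mulr_ge0 // sqr_ge0.
have gS t : 0 < t -> t <= 1 -> 2 * g (t / 2) - D * t ^+ 2 / 4 <= g t.
  move=> t0 t1; have := mid t t0 t1; rewrite /g.
  have -> : - c * (t / 2 * enorm z) ^+ 2 = - (D * t ^+ 2 / 4) by rewrite /D; field.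
  by set d := dotp q z; lra.
have pow m : 0 < (2^-1 : R) ^+ m by rewrite exprn_gt0 // invr_gt0.
have gm m : 2 ^+ m * g (2^-1 ^+ m) - D * (1 - 2^-1 ^+ m) <= g 1.
  elim: m => [|m IH]; first by rewrite !expr0 subrr mulr0 subr0 mul1r.
  have P0 := pow m.
  have P1 : (2^-1 : R) ^+ m <= 1 by rewrite exprn_ile1 // ?invr_ge0 // invf_le1 ?ler1n.
  have h := gS _ P0 P1.
  have M0 : (0 : R) < 2 ^+ m by rewrite exprn_gt0.
  have MP : 2 ^+ m * 2^-1 ^+ m = 1 :> R by rewrite -exprMn mulfV // expr1n.
  rewrite !exprS (mulrC 2^-1).
  set P := 2^-1 ^+ m in P0 P1 h IH MP *; set M := 2 ^+ m in IH M0 MP *.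
  apply: le_trans IH; move: h; rewrite -(ler_pM2l M0).
  have -> : M * (2 * g (P / 2) - D * P ^+ 2 / 4)
      = M * (2 * g (P / 2)) - (M * P) * (D * P / 4) by field.
  rewrite MP mul1r; have DP : 0 <= D * P by rewrite mulr_ge0 // ltW.
  by set G := g (P / 2); set G' := g P; lra.
apply/ler_addgt0Pr => e e0.
have [z0|z0] := eqVneq z 0.
  by rewrite gz z0 enorm0 expr0n /= mulr0 addr0 dotp0r subrr subr0 add0r ltW.
have z0' := enorm_gt0 z0.
have [|r r0 rP] := @frechet_subdiff_near f x q (e / enorm z) fq; first by rewrite divr_gt0.
have [m mP] : exists m : nat, 2^-1 ^+ m * enorm z <= r.
  have : (fun m : nat => 2^-1 ^+ m * enorm z) @ \oo --> (0 : R).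
    rewrite -[X in _ --> X](mul0r (enorm z)); apply: cvgMl.
    by apply: cvg_expr; rewrite ger0_norm ?invr_ge0 // invf_lt1 ?ltr1n.
  move=> /cvgr0_norm_le /(_ _ r0) [m _ /(_ m)] /= h; exists m.
  by rewrite (le_trans (ler_norm _)) // h.
have := rP (x + 2^-1 ^+ m *: z).
rewrite /eball /= [x + _]addrC addrK enormZ ger0_norm ?(ltW (pow m)) // => /(_ mP).
rewrite dotpZr [_ + x]addrC -/(g (2^-1 ^+ m)).
have -> : - (e / enorm z) * (2^-1 ^+ m * enorm z) = - e * 2^-1 ^+ m.
  by field; rewrite gt_eqF.
have p2 : (0 : R) < 2 ^+ m by rewrite exprn_gt0.
rewrite -(ler_pM2l p2) mulrCA -exprMn mulfV // expr1n mulr1 => h1.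
have := gm m.
have : 0 <= D * 2^-1 ^+ m by rewrite mulr_ge0 // ltW.
by rewrite mulNr -/D; lra.
Qed.

End FrechetSubdifferential.

(** * The Hamiltonian and its maximisers *)

Section Hamiltonian.
Context {R : realType} {n : nat}.
Local Notation E := 'rV[R]_n.
Variable F : E -> set E.
Hypothesis FP : SH_i F.
Implicit Types (x y p q v w u : E).
Local Notation H := (hamiltonian F).

Lemma hamiltonian_attained x p : exists2 v, F x v & dotp v p = H x p /\
  forall u, F x u -> dotp u p <= H x p.
Proof.
have [F0 _ Fc] := FP x.
have [v /[!inE] Fv vmax] := compact_EVT_max F0 Fc
  (continuous_subspaceT (@dotp_continuous R n p)).
exists v => //.
have up u : F x u -> dotp u p <= dotp v p.
  by move=> Fu; rewrite !(dotpC _ p); apply: vmax; rewrite inE.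
suff -> : H x p = dotp v p by [].
apply/eqP; rewrite eq_le /hamiltonian; apply/andP; split.
  apply: ge_sup; first by exists (dotp v p); exists v.
  by move=> _ [u Fu <-]; exact: up.
apply: sup_upper_bound; last by exists v.
split; first by exists (dotp v p); exists v.
by exists (dotp v p) => _ [u Fu <-]; exact: up.
Qed.

Lemma le_hamiltonian x p v : F x v -> dotp v p <= H x p.
Proof. by move=> Fv; have [w _ [_]] := hamiltonian_attained x p; apply. Qed.

Lemma hamiltonian_le x p (M : R) : (forall v, F x v -> dotp v p <= M) -> H x p <= M.
Proof. by move=> h; have [w Fw [<- _]] := hamiltonian_attained x p; exact: h. Qed.

Lemma hamiltonianZ x p (a : R) : 0 <= a -> H x (a *: p) = a * H x p.
Proof.
move=> a0; apply/eqP; rewrite eq_le; apply/andP; split.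
  by apply: hamiltonian_le => v Fv; rewrite dotpZr ler_wpM2l // le_hamiltonian.
have [w Fw [<- _]] := hamiltonian_attained x p.
by rewrite -dotpZr le_hamiltonian.
Qed.

Lemma hamiltonian0 x : H x 0 = 0.
Proof. by rewrite -(scale0r 0) hamiltonianZ // mul0r. Qed.

(** A closed convex set is the intersection of its supporting half-spaces, here in
a quantitative form. *)
Lemma dist_le_of_hamiltonian x v (e : R) : 0 <= e ->
  (forall q, dotp v q <= H x q + e * enorm q) ->
  exists2 u, F x u & enorm (v - u) <= e.
Proof.
move=> e0 vH; have [F0 Fcv Fc] := FP x.
have [u Fu uP] := projection_convex v F0 Fcv Fc.
exists u => //.
have Hu : H x (v - u) <= dotp u (v - u).
  by apply: hamiltonian_le => a /uP; rewrite dotpBl subr_le0.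
have : enorm (v - u) ^+ 2 <= e * enorm (v - u).
  by rewrite enorm_sqr dotpBl; have := vH (v - u); lra.
have := enorm_ge0 (v - u); rewrite le_eqVlt => /predU1P[<- //|q0].
by rewrite expr2 ler_pM2r.
Qed.

Lemma mem_of_hamiltonian x v : (forall q, dotp v q <= H x q) -> F x v.
Proof.
move=> vH; have [q|u Fu] := @dist_le_of_hamiltonian x v 0 (lexx _).
  by rewrite mul0r addr0.
move=> vu; suff /eqP : v - u = 0 by rewrite subr_eq0 => /eqP ->.
by apply: enorm0_eq0; apply/eqP; rewrite eq_le vu enorm_ge0.
Qed.

(** q -> H x q - <v, q> is nonnegative and vanishes at p, so its partial derivatives
vanish at p. *)
Lemma argmax_gradient x p v : differentiable (H x) p -> F x v ->
  dotp v p = H x p -> gradient (H x) p = v.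
Proof.
move=> dH Fv vp; apply/rowP => i; rewrite mxE.
set e := delta_mx 0 i : E.
have /cvg_ex[/= l Hl] : derivable (H x) p e by exact: diff_derivable.
have -> : 'D_e (H x) p = l by apply: cvg_lim.
have ge_v (h : R) : h * v 0 i <= H x (h *: e + p) - H x p.
  have := le_hamiltonian (h *: e + p) Fv.
  by rewrite dotpDr dotpZr dotp_delta vp; lra.
apply/eqP; rewrite eq_le; apply/andP; split.
- apply: (cvgr_to_le (cvg_dnbhs_at_left Hl)); near=> h.
  have h0 : h < 0 by near: h; exact: nbhs_left_lt.
  by rewrite /GRing.scale /= mulrC ler_ndivrMr // mulrC ge_v.
- apply: (cvgr_to_ge (cvg_dnbhs_at_right Hl)); near=> h.
  have h0 : 0 < h by near: h; exact: nbhs_right_gt.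
  by rewrite /GRing.scale /= mulrC ler_pdivlMr // mulrC ge_v.
Unshelve. all: by end_near. Qed.

(** Homogeneity makes the subdifferential inequality along the ray of p an
equality. *)
Lemma frechet_subdiff_hamiltonian_p x p v : frechet_subdiff (H x) p v ->
  H x p <= dotp v p.
Proof.
move=> Hv; have [->|p0] := eqVneq p 0; first by rewrite hamiltonian0 dotp0r.
apply/ler_addgt0Pr => e e0; have p0' := enorm_gt0 p0.
have [|r r0 rP] := frechet_subdiff_near (e := e / enorm p) Hv; first by rewrite divr_gt0.
pose t := Num.min 1 (r / enorm p).
have t0 : 0 < t by rewrite lt_min ltr01 divr_gt0.
have t1 : t <= 1 by rewrite ge_min lexx.
have := rP ((1 - t) *: p).
rewrite /eball /= -[(_ *: _) - p](_ : - t *: p = _); last first.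
  by rewrite -{3}(scale1r p) -scalerBl; congr (_ *: _); ring.
rewrite enormZ normrN gtr0_norm // -ler_pdivlMr // ge_min lexx orbT => /(_ isT).
rewrite hamiltonianZ ?subr_ge0 // dotpZr mulrCA mulNr mulrN divfK ?gt_eqF //.
by move=> h; rewrite -(ler_pM2l t0); lra.
Qed.

(** For p <> 0 every maximiser is the gradient of H x at p, which is k-Lipschitz in x.
This makes H(., q) Lipschitz with constant k|q| for every q, hence F Lipschitz in the
Hausdorff distance, which settles the case p = 0. *)
Lemma gradient_hamiltonian_selection (W : set E) (k : R) : 0 <= k ->
  (forall x p, W x -> p != 0 -> differentiable (H x) p) ->
  (forall p, p != 0 -> forall x y, W x -> W y ->
     enorm (gradient (H x) p - gradient (H y) p) <= k * enorm (x - y)) ->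
  forall x y p v, W x -> W y -> F x v -> dotp v p = H x p ->
  exists2 w, F y w & dotp w p = H y p /\ enorm (w - v) <= k * enorm (y - x).
Proof.
move=> k0 dH gH.
have sel x y p v : W x -> W y -> p != 0 -> F x v -> dotp v p = H x p ->
    exists2 w, F y w & dotp w p = H y p /\ enorm (w - v) <= k * enorm (y - x).
  move=> Wx Wy p0 Fv vp; have [w Fw [wp _]] := hamiltonian_attained y p.
  exists w => //; split => //.
  rewrite -(argmax_gradient (dH _ _ Wy p0) Fw wp).
  by rewrite -(argmax_gradient (dH _ _ Wx p0) Fv vp); exact: gH.
move=> x y p v Wx Wy Fv vp; have [p0|p0] := eqVneq p 0; last exact: (sel x).
have [||w Fw vw] := @dist_le_of_hamiltonian y v (k * enorm (y - x)).
- by rewrite mulr_ge0 // enorm_ge0.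
- move=> q; have [->|q0] := eqVneq q 0.
    by rewrite dotp0r hamiltonian0 enorm0 mulr0 addr0.
  have [u Fu [uq _]] := hamiltonian_attained x q.
  have [w Fw [wq wu]] := sel x y q u Wx Wy q0 Fu uq.
  rewrite (le_trans (le_hamiltonian q Fv)) // -uq -lerBlDl.
  rewrite (le_trans _ (ler_wpM2r (enorm_ge0 q) wu)) // enormBC.
  by rewrite (le_trans _ (dotp_le _ _)) // dotpBl lerB // le_hamiltonian.
by exists w => //; rewrite p0 dotp0r hamiltonian0 enormBC.
Qed.

(** Otherwise, by compactness, the maximum of <., p> over the elements of F x that are
far from all maximisers would be attained at a maximiser. *)
Lemma argmax_gap x p (e : R) : 0 < e -> exists2 g : R, 0 < g &
  forall u, F x u -> H x p - g <= dotp u p ->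
  exists2 v, F x v & dotp v p = H x p /\ enorm (u - v) <= e.
Proof.
move=> e0; have [F0 _ Fc] := FP x.
pose far v := (fun u : E => enorm (u - v)) @^-1` [set s | e <= s].
pose K := F x `&` \bigcap_(v in [set v | F x v /\ dotp v p = H x p]) far v.
have Kc : compact K.
  apply: compact_closedI => //; apply: closed_bigI => v _.
  by apply: preimage_closed; [move=> u _; exact: enormB_continuous|exact: closed_ge].
have farP u : F x u -> ~ K u ->
    exists2 v, F x v & dotp v p = H x p /\ enorm (u - v) <= e.
  move=> Fu /not_andP[//|/existsNP[v /not_implyP[[Fv vp] /negP]]].
  by rewrite -ltNge => /ltW uv; exists v.
have [K0|/set0P/negP] := pselect (K !=set0); last first.
  rewrite negbK => /eqP K0; exists 1 => // u Fu _.
  by apply: farP => //; rewrite K0.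
have [u0 /[!inE] -[Fu0 Ku0] umax] := compact_EVT_max K0 Kc
  (continuous_subspaceT (@dotp_continuous R n p)).
have u0H : dotp u0 p < H x p.
  rewrite lt_neqAle le_hamiltonian // andbT; apply/eqP => u0p.
  by have := Ku0 u0 (conj Fu0 u0p); rewrite /far /= subrr enorm0 leNgt e0.
exists ((H x p - dotp u0 p) / 2); first by lra.
move=> u Fu up; apply: farP => // Ku.
by have := umax u (mem_set Ku); rewrite !(dotpC p); lra.
Qed.

(** Semiconvexity of x -> H(x, p) on the unit sphere extends to all p with a constant
proportional to |p|, by homogeneity. *)
Lemma frechet_subdiff_hamiltonian_x (r c : R) x p q z : 0 <= c ->
  (forall p, esphere p -> semiconvex (eball 0 r) c (fun x => H x p)) ->
  enorm x + enorm z <= r ->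
  frechet_subdiff (fun x => H x p) x q ->
  - (c * enorm p) * enorm z ^+ 2 <= H (x + z) p - H x p - dotp q z.
Proof.
move=> c0 Hc xz /frechet_subdiff_semiconvex; apply; last first.
  by rewrite mulr_ge0 // enorm_ge0.
move=> t t0 t1; have [->|p0] := eqVneq p 0.
  by rewrite !hamiltonian0 enorm0 mulr0 oppr0 mul0r; lra.
have p0' := enorm_gt0 p0; pose p1 := (enorm p)^-1 *: p.
have Hp1 y : H y p = enorm p * H y p1.
  by rewrite -hamiltonianZ ?enorm_ge0 // scalerA mulfV ?scale1r // gt_eqF.
have p1S : esphere p1.
  by rewrite /esphere /= enormZ ger0_norm ?invr_ge0 ?enorm_ge0 // mulVf // gt_eqF.
have [_ /(_ (x + (t / 2) *: z) ((t / 2) *: z))] := Hc _ p1S.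
have -> : x + (t / 2) *: z + (t / 2) *: z = x + t *: z.
  by rewrite -addrA -scalerDl; congr (_ + _ *: _); lra.
rewrite addrK => /(_ _)/wrap[].
  move=> s /andP[s1 s2]; rewrite /eball /= subr0 -addrA scalerA -scalerDl.
  rewrite (le_trans (enorm_triangle _ _)) // (le_trans _ xz) // lerD2l enormZ.
  rewrite ler_piMl ?enorm_ge0 // ler_norml; apply/andP; split; nra.
rewrite enormZ (@ger0_norm _ (t / 2)) ?divr_ge0 ?(ltW t0) // => h.
rewrite !Hp1.
have -> : - (c * enorm p) * (t / 2 * enorm z) ^+ 2
   = enorm p * - (c * (t / 2 * enorm z) ^+ 2) by ring.
have -> : enorm p * H (x + t *: z) p1 + enorm p * H x p1
   - 2 * (enorm p * H (x + (t / 2) *: z) p1)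
   = enorm p * (H (x + t *: z) p1 + H x p1 - 2 * H (x + (t / 2) *: z) p1) by ring.
by rewrite ler_pM2l //; lra.
Qed.

End Hamiltonian.

(** * Arcs and increments *)

Section Curves.
Context {R : realType} {n : nat}.
Local Notation E := 'rV[R]_n.
Local Notation mu := (@lebesgue_measure R).
Implicit Types (x y : R -> E) (a b c s t e : R) (q v : E).

Lemma derivable_straddle y s e : derivable y s 1 -> 0 < e ->
  exists2 d : R, 0 < d & forall c t, c <= s -> s <= t -> s - d < c -> t < s + d ->
    enorm (y t - y c - (t - c) *: derive1 y s) <= e * (t - c).
Proof.
move=> /cvg_ex[/= l Hl] e0.
have -> : derive1 y s = l by rewrite derive1E; apply: cvg_lim.
have [C C0 CP] := @enorm_le_norm R n.
have eC : 0 < e / C by rewrite divr_gt0.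
move: (Hl) => /cvgrPdist_le /(_ _ eC) /nbhs_ballP[d /= d0 dP].
have one_sided h : `|h| < d -> enorm (y (s + h) - y s - h *: l) <= e * `|h|.
  move=> hd; have [->|h0] := eqVneq h 0.
    by rewrite addr0 subrr scale0r subrr enorm0 normr0 mulr0.
  have := dP h; rewrite /ball /= sub0r normrN => /(_ hd h0).
  rewrite [h%:A]mulr1 [h + s]addrC => hl.
  have -> : y (s + h) - y s - h *: l = h *: (h^-1 *: (y (s + h) - y s) - l).
    by rewrite scalerBr scalerA mulfV // scale1r.
  rewrite enormZ mulrC ler_wpM2r // (le_trans (CP _)) // mulrC -ler_pdivlMr //.
  by rewrite distrC.
exists d => // c t cs st sdc tsd.
have /one_sided : `|t - s| < d by rewrite ger0_norm; lra.
have /one_sided : `|c - s| < d by rewrite ler0_norm; lra.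
rewrite ![s + (_ - s)]addrC !subrK (ger0_norm (_ : 0 <= t - s)) ?subr_ge0 //.
rewrite (ler0_norm (_ : c - s <= 0)) ?subr_le0 // => h1 h2.
have -> : y t - y c - (t - c) *: l =
    (y t - y s - (t - s) *: l) - (y c - y s - (c - s) *: l).
  by apply/rowP => i; rewrite !mxE; ring.
by rewrite (le_trans (enorm_triangle _ _)) // enormN; lra.
Qed.

Lemma is_arcW a b c t x : is_arc a b x -> a <= c -> t <= b -> is_arc c t x.
Proof.
move=> xa ac tb e /xa[d d0 dP]; exists d => // m u v uv; apply: dP => i.
by have := uv i; lra.
Qed.

Lemma is_arc_dotp a b x q : is_arc a b x -> abs_continuous a b (fun s => dotp (x s) q).
Proof.
move=> xa e e0; have q1 : 0 < enorm q + 1 by rewrite ltr_wpDl ?enorm_ge0.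
have [d d0 dP] := xa _ (divr_gt0 e0 q1); exists d => // m u v uv dis uvd.
have := dP m u v uv dis uvd; rewrite ltr_pdivlMr //; apply: le_lt_trans.
rewrite mulr_suml; apply: ler_sum => i _; rewrite -dotpBl.
rewrite (le_trans (normr_dotp_le _ _)) // ler_wpM2l ?enorm_ge0 //.
by rewrite lerDl.
Qed.

Lemma arc_le_slope a b x q (M : R) : a <= b -> is_arc a b x ->
  {ae mu, forall s, s \in `[a, b] -> derivable x s 1 /\ dotp (derive1 x s) q <= M} ->
  dotp (x b - x a) q <= M * (b - a).
Proof.
move=> ab xa xM; rewrite dotpBl.
apply: (abs_continuous_le_slope ab (is_arc_dotp q xa)).
apply: (ae_mono xM) => s h sab; have [ds sM] := h sab => e e0.
have q1 : 0 < enorm q + 1 by rewrite ltr_wpDl ?enorm_ge0.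
have [d d0 dP] := derivable_straddle ds (divr_gt0 e0 q1).
exists d => // c t cs st sdc tsd; rewrite -dotpBl.
have -> : x t - x c = (x t - x c - (t - c) *: derive1 x s) + (t - c) *: derive1 x s.
  by rewrite subrK.
have tc : 0 <= t - c by lra.
have h1 : (t - c) * dotp (derive1 x s) q <= M * (t - c) by rewrite mulrC ler_wpM2r.
have h2 : dotp (x t - x c - (t - c) *: derive1 x s) q <= e * (t - c).
  rewrite (le_trans (dotp_le _ _)) //.
  rewrite (le_trans (ler_wpM2r (enorm_ge0 q) (dP _ _ cs st sdc tsd))) //.
  rewrite mulrAC ler_wpM2r // mulrAC ler_pdivrMr // ler_pM2l // lerDl.
  by [].
by rewrite dotpDl dotpZl; lra.
Qed.

Lemma is_arc_continuous a b x e : is_arc a b x -> 0 < e -> 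
  exists2 d : R, 0 < d & forall c t, a <= c -> c <= t -> t <= b -> t - c < d ->
    enorm (x t - x c) < e.
Proof.
move=> xa /xa[d d0 dP]; exists d => // c t ac ct tb tcd.
have := dP 1 (fun=> c) (fun=> t); rewrite !big_ord1; apply => //.
by move=> i j _ _ _; rewrite (ord1 i) (ord1 j).
Qed.

Definition curve_lipschitz (L a b : R) y := forall s t,
  a <= s -> s <= t -> t <= b -> enorm (y t - y s) <= L * (t - s).

Lemma curve_lipschitz_is_arc L a b y : 0 < L -> curve_lipschitz L a b y -> is_arc a b y.
Proof.
move=> L0 yL e e0; exists (e / L); first by rewrite divr_gt0.
move=> m u v uv _; rewrite ltr_pdivlMr // mulrC; apply: le_lt_trans.
rewrite mulr_sumr; apply: ler_sum => i _; have [? [? ?]] := uv i.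
exact: yL.
Qed.

(** A form of the differential inclusion y' in G(y) that involves no derivative: near
every s the increments of y are bounded through the support function of G (y s).
It is stable under pointwise limits of equi-Lipschitz curves. *)
Definition increments_in (G : E -> set E) a b y := forall s, a <= s -> s <= b ->
  forall q e, 0 < e -> exists2 d : R, 0 < d & forall c t,
    a <= c -> c <= s -> s <= t -> t <= b -> s - d < c -> t < s + d ->
    dotp (y t - y c) q <= (hamiltonian G (y s) q + e) * (t - c).

Lemma increments_in_ae_derive (G : E -> set E) L a b y : SH_i G -> a <= b -> 0 < L ->
  curve_lipschitz L a b y -> increments_in G a b y ->
  ae_derive a b y (fun s => G (y s)).
Proof.
move=> Gi ab L0 yL yG.
have := ae_and (ae_neq b) (lipschitz_curve_ae_derivable ab L0 yL).
move=> /ae_mono; apply => s [sb ds] sab; have dys := ds sab; split => //.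
move: sab; rewrite in_itv /= => /andP[as_ sb'].
have {}sb : s < b by rewrite lt_neqAle sb.
apply: mem_of_hamiltonian => // q; apply/ler_addgt0Pr => e e0.
have q1 : 0 < enorm q + 1 by rewrite ltr_wpDl ?enorm_ge0.
pose e1 := e / (enorm q + 1).
have e10 : 0 < e1 by rewrite divr_gt0.
have [d1 d10 d1P] := derivable_straddle dys e10.
have [d2 d20 d2P] := yG s as_ (ltW sb) q e1 e10.
(* A forward step that is short enough for both estimates and stays in [a, b]. *)
pose m := Num.min (d1 / 2) (Num.min (d2 / 2) (b - s)).
have m0 : 0 < m by rewrite !lt_min !divr_gt0 // subr_gt0.
have m1 : m <= d1 / 2 by rewrite ge_min lexx.
have m2 : m <= d2 / 2 by rewrite !ge_min lexx !orbT.
have m3 : m <= b - s by rewrite !ge_min lexx !orbT.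
have /d1P /(_ _ _ _) : s <= s by [].
move=> /(_ (s + m)) h1.
have {h1} : enorm (y (s + m) - y s - (s + m - s) *: derive1 y s) <= e1 * (s + m - s).
  by apply: h1; lra.
have : dotp (y (s + m) - y s) q <= (hamiltonian G (y s) q + e1) * (s + m - s).
  by apply: d2P; lra.
rewrite [s + m]addrC addrK => h2 h1.
have := dotp_ge (y (m + s) - y s - m *: derive1 y s) q.
rewrite dotpBl dotpZl => h3.
have h4 : enorm (y (m + s) - y s - m *: derive1 y s) * enorm q <= e1 * m * enorm q.
  by rewrite ler_wpM2r ?enorm_ge0.
rewrite -(ler_pM2l m0).
have h5 : e1 * (enorm q + 1) = e by rewrite mulfVK // gt_eqF.
have -> : m * (hamiltonian G (y s) q + e) = (hamiltonian G (y s) q + e1) * m + e1 * m * enorm q.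
  by rewrite -h5; ring.
by lra.
Qed.

(** The right-hand side of the inclusion obtained by reversing time. *)
Definition oppF (G : E -> set E) : E -> set E := fun u => [set - v | v in G u].

Lemma increments_in_reverse (G : E -> set E) a b y : SH_i G ->
  increments_in (oppF G) (- b) (- a) y ->
  increments_in G a b (fun s => y (- s)).
Proof.
move=> Gi yG s as_ sb q e e0.
have [||d d0 dP] := yG (- s) _ _ (- q) e e0; rewrite ?lerN2 //.
exists d => // c t ac cs st tb sdc tsd.
have := dP (- t) (- c); rewrite !lerN2 => /(_ tb st cs ac) h.
have {h} := h ltac:(lra) ltac:(lra).
have HE : hamiltonian (oppF G) (y (- s)) (- q)
    = hamiltonian G (y (- s)) q.
  rewrite /hamiltonian; congr sup; apply/seteqP; split => r [v].
    by move=> [w Gw <-] <-; exists w => //; rewrite dotpNl dotpNr opprK.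
  by move=> Gv <-; exists (- v); [exists v|rewrite dotpNl dotpNr opprK].
by rewrite dotpNr -dotpNl opprB opprK [- c + t]addrC HE.
Qed.

End Curves.

(** * Backward Euler curves tracking a reference curve *)

Section PointwiseLimit.
Context {R : realType} {n : nat}.
Local Notation E := 'rV[R]_n.

(** Tychonoff compactness along an ultrafilter on the indices: a pointwise bounded
sequence of curves has a pointwise limit, which is approximated simultaneously at any
finite number of times; three times are enough below. *)
Lemma pointwise_limit (u : nat -> R -> E) (A : set R) (x0 : E) (M : R) :
  (forall j s, A s -> enorm (u j s - x0) <= M) ->
  exists y : R -> E, forall e, 0 < e -> forall N s1 s2 s3, A s1 -> A s2 -> A s3 ->
    exists j, [/\ (N <= j)%N, enorm (u j s1 - y s1) <= e,
                  enorm (u j s2 - y s2) <= e & enorm (u j s3 - y s3) <= e].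
Proof.
move=> uM; have [G [GU GN]] := @ultraFilterLemma nat \oo _.
have GF : ProperFilter G by exact: ultra_proper.
have lim s : exists ys : E, A s -> forall e, 0 < e ->
    G [set j | enorm (u j s - ys) <= e].
  have [As|nAs] := pselect (A s); last by exists 0.
  have uG : ((fun j => u j s) @ G) (eball x0 M).
    by apply: (@filterS _ G _ setT) filterT => j _; exact: uM.
  have [ys [_ ysc]] := @eball_compact R n x0 M ((fun j => u j s) @ G) _ uG.
  exists ys => _ e e0.
  have [//|Gc] := in_ultra_setVsetC [set j | enorm (u j s - ys) <= e] GU.
  have nb : nbhs ys (eball ys e) by apply/nbhs_eballP; exists e.
  by have [z [/= zn]] := ysc (~` eball ys e) (eball ys e) Gc nb.
have [y yP] := choice lim; exists y => e e0 N s1 s2 s3 A1 A2 A3.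
have GNN : G [set j | (N <= j)%N] by apply: GN; exists N.
have := @filter_ex _ G _ _
  (filterI (filterI GNN (yP s1 A1 e e0)) (filterI (yP s2 A2 e e0) (yP s3 A3 e e0))).
by move=> [j [[? ?] [? ?]]]; exists j.
Qed.

End PointwiseLimit.

Section TrackingCurves.
Context {R : realType} {n : nat}.
Local Notation E := 'rV[R]_n.
Implicit Types (F : E -> set E) (a b k c L rho : R) (xref p y : R -> E) (h : E).

(** One backward Euler step tagged at s, from the deviation z at time t to z' at time l.
The two estimates are the discrete forms of |z|' >= - k|z| and <p, z>' >= - c|z|^2. *)
Definition tracking_step F a b k c xref p :=
  forall s e : R, a <= s -> s <= b -> 0 < e ->
  exists2 d : R, 0 < d & forall l t, a <= l -> l <= s -> s <= t -> t <= b ->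
    s - d < l -> t < s + d -> forall z, enorm z <= 1 ->
    exists2 w, F (xref s + z) w &
      let z' := z + (xref t - xref l) - (t - l) *: w in
      enorm (z' - z) <= (t - l) * (k * enorm z + e) /\
      - ((t - l) * (c * enorm z ^+ 2 + e)) <= dotp (p t) z - dotp (p l) z'.

(** The velocities of y are allowed to be taken in F at points that are e-close to
the curve. *)
Definition approx_solution F b L xref h (e l : R) y :=
  [/\ y b = xref b + h,
      curve_lipschitz L l b y &
      forall s t q (M : R), l <= s -> s <= t -> t <= b ->
        (forall r v, s <= r -> r <= t -> enorm v <= e ->
           hamiltonian F (y r + v) q <= M) ->
        dotp (y t - y s) q <= M * (t - s)].

Definition extend_left (y : R -> E) (t : R) (w : E) (r : R) :=
  if t <= r then y r else y t - (t - r) *: w.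

Lemma extend_leftE y t w r1 r2 : r1 <= t -> r2 <= t ->
  extend_left y t w r2 - extend_left y t w r1 = (r2 - r1) *: w.
Proof.
have ext r : r <= t -> extend_left y t w r = y t - (t - r) *: w.
  move=> rt; rewrite /extend_left; case: ifPn => // tr.
  have -> : r = t by apply/eqP; rewrite eq_le rt.
  by rewrite subrr scale0r subr0.
by move=> h1 h2; rewrite !ext //; apply/rowP => i; rewrite !mxE; ring.
Qed.

Lemma approx_solution_extend_left F b L xref h e l t y u w : SH_i F ->
  l <= t -> t <= b -> approx_solution F b L xref h e t y ->
  F u w -> enorm w <= L ->
  (forall r, l <= r -> r <= t -> enorm (u - extend_left y t w r) <= e) ->
  approx_solution F b L xref h e l (extend_left y t w).
Proof.
move=> FP lt_ tb [yb yL yM] Fw wL ue.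
set y' := extend_left y t w in ue *.
have y'E r : t <= r -> y' r = y r by rewrite /y' /extend_left => ->.
split; first by rewrite y'E.
- have left r1 r2 : r1 <= r2 -> r2 <= t -> enorm (y' r2 - y' r1) <= L * (r2 - r1).
    move=> r12 r2t; rewrite extend_leftE ?(le_trans r12) // enormZ ger0_norm ?subr_ge0 //.
    by rewrite mulrC ler_wpM2r // subr_ge0.
  have right r1 r2 : t <= r1 -> r1 <= r2 -> r2 <= b ->
      enorm (y' r2 - y' r1) <= L * (r2 - r1).
    by move=> tr r12 r2b; rewrite !y'E ?(le_trans tr) //; exact: yL.
  move=> r1 r2 lr1 r12 r2b.
  have [r2t|/ltW tr2] := leP r2 t; first exact: left.
  have [r1t|/ltW tr1] := leP r1 t; last exact: right.
  rewrite (le_trans (enorm_triangleB (y' t) _ _)) //.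
  have := left r1 t r1t (lexx _); have := right t r2 (lexx _) tr2 r2b.
  by clear; lra.
- have left q M r1 r2 : l <= r1 -> r1 <= r2 -> r2 <= t ->
      (forall r v, r1 <= r -> r <= r2 -> enorm v <= e -> hamiltonian F (y' r + v) q <= M) ->
      dotp (y' r2 - y' r1) q <= M * (r2 - r1).
    move=> lr1 r12 r2t HM; rewrite extend_leftE ?(le_trans r12) // dotpZl mulrC.
    rewrite ler_wpM2r ?subr_ge0 // (le_trans (le_hamiltonian FP q Fw)) //.
    rewrite -[u](subrK (y' r1)) addrC; apply: HM => //.
    by apply: ue => //; exact: le_trans r2t.
  have right q M r1 r2 : t <= r1 -> r1 <= r2 -> r2 <= b ->
      (forall r v, r1 <= r -> r <= r2 -> enorm v <= e -> hamiltonian F (y' r + v) q <= M) ->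
      dotp (y' r2 - y' r1) q <= M * (r2 - r1).
    move=> tr1 r12 r2b HM; rewrite !y'E ?(le_trans tr1) //.
    apply: yM => // r v r1r rr2 ve.
    by rewrite -y'E ?(le_trans tr1) //; exact: HM.
  move=> r1 r2 q M lr1 r12 r2b HM.
  have [r2t|/ltW tr2] := leP r2 t; first exact: left.
  have [r1t|/ltW tr1] := leP r1 t; last exact: right.
  have -> : y' r2 - y' r1 = (y' r2 - y' t) + (y' t - y' r1) by rewrite addrA subrK.
  rewrite dotpDl.
  have h1 : dotp (y' t - y' r1) q <= M * (t - r1).
    by apply: left => // r v r1r rt ve; apply: HM => //; exact: le_trans tr2.
  have h2 : dotp (y' r2 - y' t) q <= M * (r2 - t).
    by apply: right => // r v tr rr2 ve; apply: HM => //; exact: le_trans tr.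
  by move: h1 h2; clear; lra.
Qed.

End TrackingCurves.

Section EulerScheme.
Context {R : realType} {n : nat}.
Local Notation E := 'rV[R]_n.
Variables (F : E -> set E) (a b k c L rho : R) (xref p : R -> E) (h : E).
Hypothesis FP : SH_i F.
Hypotheses (ab : a <= b) (k0 : 0 <= k) (c0 : 0 <= c) (L0 : 0 < L).
Hypothesis h_rho : enorm h <= rho.
(* B bounds the deviation of all the Euler curves, whose accumulated errors are at most
   rho; local steps need a deviation of at most 1. *)
Let B := expR (k * (b - a)) * (2 * rho).
Hypothesis B1 : B <= 1.
Hypothesis F_bound : forall s z w, a <= s -> s <= b -> enorm z <= 1 ->
  F (xref s + z) w -> enorm w <= L.
Hypothesis xref_cont : forall s e, a <= s -> s <= b -> 0 < e ->
  exists2 d : R, 0 < d & forall t, a <= t -> t <= b -> s - d < t -> t < s + d ->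
    enorm (xref t - xref s) <= e.

Hypothesis step : tracking_step F a b k c xref p.

(** The factor exp(k(b - l)) absorbs the growth of the deviation at the rate k, since
1 + k(t - l) <= exp(k(t - l)); the terms with e are the accumulated errors. *)
Lemma approx_solution_exists (e : R) : 0 < e -> e * (b - a) <= rho ->
  exists y, [/\ approx_solution F b L xref h e a y,
    enorm (y a - xref a) <= B &
    - ((b - a) * (c * B ^+ 2 + e)) <= dotp (p b) h - dotp (p a) (y a - xref a)].
Proof.
move=> e0 e_rho.
have [[[ab_ L0_] h_rho_] B1_] := (ab, L0, h_rho, B1).
have bound l : a <= l -> l <= b -> expR (k * (b - l)) * (enorm h + e * (b - l)) <= B.
  move=> al lb; rewrite /B; apply: ler_pM; rewrite ?expR_ge0 //.
  - by rewrite addr_ge0 ?enorm_ge0 // mulr_ge0 ?subr_ge0 // ltW.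
  - by rewrite ler_expR ler_wpM2l //; lra.
  - have : e * (b - l) <= e * (b - a) by rewrite ler_pM2l //; lra.
    by move: h_rho e_rho; lra.
pose Q l := exists y, [/\ approx_solution F b L xref h e l y,
    enorm (y l - xref l) <= expR (k * (b - l)) * (enorm h + e * (b - l)) &
    - ((b - l) * (c * B ^+ 2 + e)) <= dotp (p b) h - dotp (p l) (y l - xref l)].
suff [y [y1 y2 y3]] : Q a.
  by exists y; split => //; rewrite (le_trans y2) // bound.
apply: (interval_induction ab).
  exists (fun=> xref b + h).
  have hE : xref b + h - xref b = h by rewrite addrC addKr.
  split; [split => //| |].
  - by move=> s t bs st tb; rewrite subrr enorm0 mulr_ge0 ?subr_ge0 // ltW.
  - move=> s t q M bs st tb _; rewrite subrr dotp0l.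
    have -> : t = s by apply/eqP; rewrite eq_le st (le_trans tb bs).
    by rewrite subrr mulr0.
  - by rewrite hE !subrr !mulr0 expR0 mul1r addr0.
  - by rewrite hE !subrr mul0r oppr0.
move=> s /andP[as_ sb].
have e2 : 0 < e / 2 by lra.
have [d1 d10 d1P] := xref_cont as_ sb e2.
have [d2 d20 d2P] := step as_ sb e0.
(* Over a duration of at most 2 d3 a velocity bounded by L moves the curve by e / 2. *)
pose d3 := e / (4 * L).
have L4 : 0 < 4 * L by lra.
have d30 : 0 < d3 by rewrite divr_gt0.
have d3E : d3 * (4 * L) = e by rewrite mulfVK // gt_eqF.
pose d := Num.min d1 (Num.min d2 d3).
have dd1 : d <= d1 by rewrite ge_min lexx.
have dd2 : d <= d2 by rewrite !ge_min lexx !orbT.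
have dd3 : d <= d3 by rewrite !ge_min lexx !orbT.
exists d; first by rewrite !lt_min d10 d20.
move=> l t al ls st tb sdl tsd [y [y_sol yz yp]].
have at_ : a <= t by lra.
have lt_ : l <= t by lra.
pose z := y t - xref t.
have zB : enorm z <= B by rewrite (le_trans yz) // bound.
have z1 : enorm z <= 1 by rewrite (le_trans zB).
have [|||||||w Fw [wz wp]] := d2P l t _ _ _ _ _ _ z; try by [| lra].
have wL : enorm w <= L by exact: (F_bound as_ sb z1 Fw).
have tl0 : 0 <= t - l by rewrite subr_ge0.
pose y' := extend_left y t w.
have z'E : y' l - xref l = z + (xref t - xref l) - (t - l) *: w.
  have := @extend_leftE _ _ y t w l t lt_ (lexx _); rewrite -/y' => hy.
  have -> : y' l = y t - (t - l) *: w by rewrite -hy /y' /extend_left lexx subKr.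
  by rewrite /z; apply/rowP => i; rewrite !mxE; ring.
exists y'; split.
- apply: (@approx_solution_extend_left _ _ _ _ _ _ _ _ _ _ _ (xref s + z) w) => // r lr rt.
  have hy := @extend_leftE _ _ y t w r t rt (lexx _).
  have -> : xref s + z - extend_left y t w r = (t - r) *: w - (xref t - xref s).
    rewrite -hy {2}/extend_left lexx /z.
    by apply/rowP => i; rewrite !mxE; ring.
  rewrite (le_trans (enorm_triangle _ _)) // enormN enormZ ger0_norm ?subr_ge0 //.
  have h1 : enorm (xref t - xref s) <= e / 2.
    apply: d1P => //; first by rewrite (lt_le_trans _ st) // gtrBl.
    by rewrite (lt_le_trans tsd) // lerD2l.
  have h2 : (t - r) * enorm w <= (2 * d3) * L.
    apply: ler_pM; rewrite ?subr_ge0 ?enorm_ge0 //.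
    by move: sdl tsd dd3 lr; lra.
  by move: h1 h2 d3E; lra.
- rewrite z'E; set z' := z + _ - _ in wz *.
  have h1 : enorm z' <= enorm z + (t - l) * (k * enorm z + e).
    by rewrite -[z'](subrK z) (le_trans (enorm_triangle _ _)) // addrC lerD2l.
  have h2 : 1 + k * (t - l) <= expR (k * (t - l)) by exact: expR_ge1Dx.
  have h3 : (1 + k * (t - l)) * enorm z <= expR (k * (b - l)) * (enorm h + e * (b - t)).
    have -> : k * (b - l) = k * (t - l) + k * (b - t) by ring.
    rewrite expRD -mulrA; apply: ler_pM => //; rewrite ?enorm_ge0 //.
    by rewrite addr_ge0 // mulr_ge0.
  have h4 : e * (t - l) <= expR (k * (b - l)) * (e * (t - l)).
    rewrite ler_peMl ?mulr_ge0 ?(ltW e0) // -expR0 ler_expR mulr_ge0 //; lra.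
  have -> : e * (b - l) = e * (b - t) + e * (t - l) by ring.
  by rewrite mulrDr; move: h1 h3 h4; rewrite !mulrDr; lra.
- rewrite z'E; set z' := z + _ - _ in wp *.
  have zB2 : c * enorm z ^+ 2 <= c * B ^+ 2.
    by rewrite ler_wpM2l // ler_pXn2r ?nnegrE ?enorm_ge0 // (le_trans (enorm_ge0 z)).
  have : (t - l) * (c * enorm z ^+ 2 + e) <= (t - l) * (c * B ^+ 2 + e).
    by rewrite ler_wpM2l // lerD2r.
  by move: yp wp; rewrite -/z; lra.
Qed.

End EulerScheme.

Section EulerLimit.
Context {R : realType} {n : nat}.
Local Notation E := 'rV[R]_n.
Implicit Types (F : E -> set E) (a b k c L rho : R) (xref p y : R -> E) (h : E).

Lemma hamiltonian_upper_continuous F x q e : SH_i F -> SH_ii F -> 0 < e ->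
  exists2 d : R, 0 < d & forall z, enorm (z - x) <= d ->
    hamiltonian F z q <= hamiltonian F x q + e.
Proof.
move=> FP FL e0; have [K [c [Kx c0 KP]]] := FL x.
have [r r0 rK] := (nbhs_eballP _ _).1 Kx.
have q1 : 0 < c * (enorm q + 1) by rewrite mulr_gt0 // ltr_wpDl ?enorm_ge0.
exists (Num.min r (e / (c * (enorm q + 1)))); first by rewrite lt_min r0 divr_gt0.
move=> z; rewrite le_min => /andP[zr]; rewrite ler_pdivlMr // => ze.
apply: hamiltonian_le => // v.
have Kxx : K x by apply: rK; rewrite /eball /= subrr enorm0 ltW.
have Kz : K z by exact: rK.
move=> /(KP z x Kz Kxx)[w Fw [u]]; rewrite /eball /= subr0 => u1 <-.
rewrite dotpDl dotpZl lerD ?le_hamiltonian //; apply: le_trans ze.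
rewrite mulrC (mulrC c) mulrA -(mulrA (dotp u q)) mulrC mulrC.
have cz : 0 <= c * enorm (z - x) by rewrite mulr_ge0 ?enorm_ge0 // ltW.
have uq : dotp u q <= enorm q + 1.
  rewrite (le_trans (dotp_le _ _)) // (@le_trans _ _ (1 * enorm q)) //.
    by rewrite ler_wpM2r ?enorm_ge0.
  by rewrite mul1r lerDl.
have := ler_wpM2l cz uq.
lra.
Qed.

Lemma approx_solution_mono F b L xref h e e' l y : e' <= e ->
  approx_solution F b L xref h e' l y -> approx_solution F b L xref h e l y.
Proof.
move=> ee [h1 h2 h3]; split => // s t q M ls st tb HM; apply: h3 => // r v sr rt ve.
by apply: HM => //; exact: le_trans ve ee.
Qed.

(** Limit of the Euler curves: each conclusion is a closed condition on the values of the
curve at no more than three times, so pointwise convergence is enough. *)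
Lemma tracking_curve F a b k c L rho xref p h :
  SH_i F -> SH_ii F -> a <= b -> 0 <= k -> 0 <= c -> 0 < L -> 0 < rho ->
  enorm h <= rho -> expR (k * (b - a)) * (2 * rho) <= 1 ->
  (forall s z w, a <= s -> s <= b -> enorm z <= 1 -> F (xref s + z) w -> enorm w <= L) ->
  (forall s e, a <= s -> s <= b -> 0 < e ->
    exists2 d : R, 0 < d & forall t, a <= t -> t <= b -> s - d < t -> t < s + d ->
      enorm (xref t - xref s) <= e) ->
  tracking_step F a b k c xref p ->
  let B := expR (k * (b - a)) * (2 * rho) in
  exists y, [/\ y b = xref b + h, curve_lipschitz L a b y, increments_in F a b y,
    enorm (y a - xref a) <= B &
    - ((b - a) * (c * B ^+ 2)) <= dotp (p b) h - dotp (p a) (y a - xref a)].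
Proof.
move=> FP FL ab k0 c0 L0 rho0 h_rho B1 Fb xc step B.
have ba1 : 0 < b - a + 1 by lra.
(* Error levels tending to 0 whose accumulated effect stays below rho. *)
pose eps (j : nat) : R := rho / (b - a + 1) / j.+1%:R.
have eps0 j : 0 < eps j by rewrite /eps !divr_gt0.
have eps_rho j : eps j * (b - a) <= rho.
  rewrite /eps mulrAC ler_pdivrMr // mulrAC ler_pdivrMr // -mulrA ler_pM2l //.
  have : (1 : R) <= j.+1%:R by rewrite ler1n.
  by nra.
have eps_small e : 0 < e -> exists N, forall j, (N <= j)%N -> eps j <= e.
  move=> e0; exists (Num.bound (rho / (b - a + 1) / e)) => j Nj.
  rewrite /eps ler_pdivrMr // -ler_pdivrMl // mulrC.
  have q0 : 0 <= rho / (b - a + 1) / e by rewrite !divr_ge0 ?ltW.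
  by rewrite (le_trans (ltW (archi_boundP q0))) // ler_nat (leq_trans Nj).
have [u uP] := choice (fun j => approx_solution_exists FP ab k0 c0 L0 h_rho B1
  Fb xc step (eps0 j) (eps_rho j)).
have uM j s : `[a, b]%classic s -> enorm (u j s - (xref b + h)) <= L * (b - a).
  rewrite /= in_itv /= => /andP[as_ sb]; have [[ub uL _] _ _] := uP j.
  rewrite -ub enormBC (le_trans (uL _ _ as_ sb (lexx _))) // ler_pM2l //; lra.
have [y yP] := pointwise_limit uM; exists y.
have {yP}close e s1 s2 s3 : 0 < e -> a <= s1 <= b -> a <= s2 <= b -> a <= s3 <= b ->
  exists v, [/\ approx_solution F b L xref h e a v /\
      (enorm (v a - xref a) <= B /\
      - ((b - a) * (c * B ^+ 2 + e)) <= dotp (p b) h - dotp (p a) (v a - xref a)),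
    enorm (v s1 - y s1) <= e, enorm (v s2 - y s2) <= e & enorm (v s3 - y s3) <= e].
  move=> e0 h1 h2 h3; have [N NP] := eps_small e e0.
  have [||| j [Nj j1 j2 j3]] := yP e e0 N s1 s2 s3; rewrite /= ?in_itv //.
  exists (u j); split => //; have [u1 u2 u3] := uP j; have ej := NP _ Nj.
  split; first exact: approx_solution_mono u1.
  split => //; rewrite (le_trans _ u3) // lerN2 ler_wpM2l ?subr_ge0 //.
  by rewrite lerD2l.
have aab : a <= a <= b by rewrite lexx.
have bab : a <= b <= b by rewrite lexx andbT.
split.
- apply/eqP; rewrite -subr_eq0; apply/eqP/enorm0_eq0/eqP.
  rewrite eq_le enorm_ge0 andbT.
  apply/ler_addgt0Pr => e e0; rewrite add0r.
  have [v [[[vb _ _] _] vy _ _]] := close e b b b e0 bab bab bab.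
  by rewrite enormBC -vb.
- move=> s t as_ st tb; apply/ler_addgt0Pr => e e0.
  have e2 : 0 < e / 2 by lra.
  have sab : a <= s <= b by rewrite as_ (le_trans st).
  have tab : a <= t <= b by rewrite tb (le_trans as_).
  have [v [[[_ vL _] _] vs vt _]] := close (e / 2) s t t e2 sab tab tab.
  have := vL s t as_ st tb.
  have := enorm_triangleB (v t) (y t) (y s); have := enorm_triangleB (v s) (v t) (y s).
  by rewrite (enormBC (y t) (v t)); lra.
- move=> s as_ sb q e e0.
  have [d0 d00 d0P] := hamiltonian_upper_continuous (y s) q FP FL e0.
  have L2 : 0 < 2 * L by lra.
  have d2L : 0 < d0 / (2 * L) by rewrite divr_gt0.
  exists (d0 / (2 * L)) => // l t al ls st tb sdl tsd.
  apply/ler_addgt0Pr => e1 e10.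
  have q1 : 0 < 2 * enorm q + 1 by have := enorm_ge0 q; lra.
  pose e2 := Num.min (d0 / 4) (e1 / (2 * enorm q + 1)).
  have e20 : 0 < e2 by rewrite lt_min !divr_gt0.
  have e2d : e2 <= d0 / 4 by rewrite ge_min lexx.
  have e2q : e2 * (2 * enorm q + 1) <= e1.
    by rewrite -ler_pdivlMr // ge_min lexx orbT.
  have lab : a <= l <= b by rewrite al (le_trans ls).
  have sab : a <= s <= b by rewrite as_ sb.
  have tab : a <= t <= b by rewrite tb (le_trans as_).
  have [v [[[_ vL vH] _] vl vs vt]] := close e2 l s t e20 lab sab tab.
  have dL : d0 / (2 * L) * L = d0 / 2 by field; rewrite gt_eqF.
  have h0 : dotp (v t - v l) q <= (hamiltonian F (y s) q + e) * (t - l).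
    apply: vH => //; first exact: le_trans st.
    move=> r w lr rt we; apply: d0P.
    have -> : v r + w - y s = (v r - v s) + w + (v s - y s).
      by apply/rowP => i; rewrite !mxE; ring.
    rewrite (le_trans (enorm_triangle _ _)) //.
    have := enorm_triangle (v r - v s) w.
    have : enorm (v r - v s) <= d0 / 2.
      rewrite -dL mulrC; have [rs|/ltW sr] := leP r s.
        rewrite enormBC (le_trans (vL _ _ _ rs sb)) ?(le_trans al) // ler_pM2l //; lra.
      rewrite (le_trans (vL _ _ as_ sr _)) ?(le_trans rt) // ler_pM2l //; lra.
    lra.
  have -> : y t - y l = (v t - v l) - (v t - y t) + (v l - y l).
    by apply/rowP => i; rewrite !mxE; ring.
  rewrite dotpDl (dotpBl (v t - v l)).
  have h1 : dotp (v l - y l) q <= e2 * enorm q.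
    by rewrite (le_trans (dotp_le _ _)) // ler_wpM2r ?enorm_ge0.
  have h2 : - (e2 * enorm q) <= dotp (v t - y t) q.
    by rewrite (le_trans _ (dotp_ge _ _)) // lerN2 ler_wpM2r ?enorm_ge0.
  by move: h0 h1 h2 e2q e20; clear; lra.
- apply/ler_addgt0Pr => e e0.
  have [v [[_ [vB _]] va _ _]] := close e a a a e0 aab aab aab.
  rewrite (le_trans (enorm_triangleB (v a) _ _)) // addrC lerD // enormBC.
  exact: va.
- apply/ler_addgt0Pr => e e0.
  have pa : 0 < b - a + enorm (p a) + 1 by have := enorm_ge0 (p a); lra.
  pose e1 := e / (b - a + enorm (p a) + 1).
  have e10 : 0 < e1 by rewrite divr_gt0.
  have e1E : e1 * (b - a + enorm (p a) + 1) = e by rewrite mulfVK // gt_eqF.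
  have [v [[_ [_ vp]] va _ _]] := close e1 a a a e10 aab aab aab.
  have -> : y a - xref a = (v a - xref a) - (v a - y a).
    by apply/rowP => i; rewrite !mxE; ring.
  rewrite (dotpBr (v a - xref a)).
  have h1 : - (enorm (p a) * e1) <= dotp (p a) (v a - y a).
    by rewrite (le_trans _ (dotp_ge _ _)) // lerN2 ler_wpM2l ?enorm_ge0.
  by move: h1 vp e1E e10; clear; lra.
Qed.

End EulerLimit.

(** * Trajectories and monotonicity of the value function *)

Section Trajectories.
Context {R : realType} {n : nat}.
Local Notation E := 'rV[R]_n.
Local Notation mu := (@lebesgue_measure R).
Implicit Types (F : E -> set E) (x y z : R -> E) (a b c s t e : R) (q v : E).

Lemma arc_le_speed a b x (M : R) : a <= b -> 0 <= M -> is_arc a b x ->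
  {ae mu, forall s, s \in `[a, b] -> derivable x s 1 /\ enorm (derive1 x s) <= M} ->
  enorm (x b - x a) <= M * (b - a).
Proof.
move=> ab M0 xa xM; set q := x b - x a.
have h : dotp q q <= (M * enorm q) * (b - a).
  apply: arc_le_slope => //; apply: (ae_mono xM) => s h sab.
  have [ds sM] := h sab; split => //.
  by rewrite (le_trans (dotp_le _ _)) // ler_wpM2r ?enorm_ge0.
have := enorm_ge0 q; rewrite le_eqVlt => /predU1P[<-|q0].
  by rewrite mulr_ge0 // subr_ge0.
by rewrite -(ler_pM2r q0) -expr2 enorm_sqr mulrAC.
Qed.

Lemma is_arc_eq a b x y : (forall s, a <= s <= b -> x s = y s) ->
  is_arc a b x -> is_arc a b y.
Proof.
move=> xy xa e /xa[d d0 dP]; exists d => // m u v uv dis uvd.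
rewrite (le_lt_trans _ (dP m u v uv dis uvd)) //; apply: ler_sum => i _.
by have [? [? ?]] := uv i; rewrite !xy //; apply/andP; split; lra.
Qed.

Lemma min_max_cut (u v c : R) : u <= v ->
  let u1 := Num.min u c in let v1 := Num.min v c in
  let u2 := Num.max u c in let v2 := Num.max v c in
  [/\ u1 <= v1 <= c, c <= u2 <= v2, v1 - u1 + (v2 - u2) = v - u,
      `]u1, v1[ `<=` `]u, v[%classic & `]u2, v2[ `<=` `]u, v[%classic].
Proof.
rewrite /Num.min /Num.max /=.
case: (ltP u c) => uc; case: (ltP v c) => vc uv.
- by split; try lra; move=> r /=; rewrite !in_itv /=; lra.
- by split; try lra; move=> r /=; rewrite !in_itv /=; lra.
- by exfalso; lra.
- by split; try lra; move=> r /=; rewrite !in_itv /=; lra.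
Qed.

(** An interval of the family that straddles c is cut at c. *)
Lemma is_arc_glue a b c x : a <= c <= b -> is_arc a c x -> is_arc c b x ->
  is_arc a b x.
Proof.
move=> /andP[ac cb] x1 x2 e e0; have e2 : 0 < e / 2 by lra.
have [d1 d10 d1P] := x1 _ e2; have [d2 d20 d2P] := x2 _ e2.
exists (Num.min d1 d2); first by rewrite lt_min d10.
move=> m u v uv dis; rewrite lt_min => /andP[uv1 uv2].
pose u1 i := Num.min (u i) c; pose v1 i := Num.min (v i) c.
pose u2 i := Num.max (u i) c; pose v2 i := Num.max (v i) c.
have cut i := min_max_cut c (uv i).2.1.
have uv1P i : a <= u1 i /\ u1 i <= v1 i /\ v1 i <= c.
  have [/andP[h1 h2] _ _ _ _] := cut i; split => //.
  by rewrite le_min ac (uv i).1.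
have uv2P i : c <= u2 i /\ u2 i <= v2 i /\ v2 i <= b.
  have [_ /andP[h1 h2] _ _ _] := cut i; split => //; split => //.
  by rewrite ge_max cb (uv i).2.2.
have dis1 : trivIset setT (fun i => `]u1 i, v1 i[%classic).
  move=> i j _ _ [r [ri rj]]; apply: dis => //; exists r.
  by have [_ _ _ hi _] := cut i; have [_ _ _ hj _] := cut j; split; [exact: hi|exact: hj].
have dis2 : trivIset setT (fun i => `]u2 i, v2 i[%classic).
  move=> i j _ _ [r [ri rj]]; apply: dis => //; exists r.
  by have [_ _ _ _ hi] := cut i; have [_ _ _ _ hj] := cut j; split; [exact: hi|exact: hj].
have sum1 : \sum_i (v1 i - u1 i) < d1.
  apply: le_lt_trans uv1; apply: ler_sum => i _.
  by have [_ /andP[_ h] <- _ _] := cut i; rewrite lerDl subr_ge0.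
have sum2 : \sum_i (v2 i - u2 i) < d2.
  apply: le_lt_trans uv2; apply: ler_sum => i _.
  by have [/andP[h _] _ <- _ _] := cut i; rewrite lerDr subr_ge0.
have := d1P m u1 v1 uv1P dis1 sum1; have := d2P m u2 v2 uv2P dis2 sum2.
suff : \sum_i enorm (x (v i) - x (u i)) <=
    \sum_i enorm (x (v1 i) - x (u1 i)) + \sum_i enorm (x (v2 i) - x (u2 i)) by lra.
rewrite -big_split; apply: ler_sum => i _ /=; have [_ [uv_i _]] := uv i.
rewrite /v1 /v2 /u1 /u2; have [vc|/ltW cv] := leP (v i) c.
  by rewrite !(min_l, max_r) ?(le_trans uv_i) // lerDl enorm_ge0.
have [uc|/ltW cu] := leP (u i) c.
  by rewrite addrC; exact: enorm_triangleB.
by rewrite subrr enorm0 add0r.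
Qed.

Lemma ae_derive_eq a b x y (P : R -> set E) :
  (forall s, a < s < b -> x s = y s) -> ae_derive a b x P -> ae_derive a b y P.
Proof.
move=> xy xP; have := ae_and (ae_and (ae_neq a) (ae_neq b)) xP.
move=> /ae_mono; apply => s [[sa sb] h] sab; have [dx Px] := h sab.
have so : s \in `]a, b[.
  move: sab; rewrite !in_itv /= => /andP[? ?].
  by rewrite !lt_neqAle eq_sym sa sb /=; apply/andP; split.
have near_xy : \forall t \near s, x t = y t.
  have near_s : \forall t \near s, t \in `]a, b[ by exact: near_in_itvoo.
  by apply: filterS near_s => t; rewrite in_itv /= => /xy.
split; first exact: near_eq_derivable near_xy dx.
by rewrite derive1E -(near_eq_derive _ near_xy) -derive1E.
Unshelve. all: by end_near. Qed.

Lemma ae_derive_glue a b c y (P : R -> set E) :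
  ae_derive a c y P -> ae_derive c b y P -> ae_derive a b y P.
Proof.
move=> h1 h2; have := ae_and h1 h2.
move=> /ae_mono; apply => s [g1 g2]; rewrite in_itv /= => /andP[as_ sb].
have [sc|/ltW cs] := leP s c; first by apply: g1; rewrite in_itv /= as_.
by apply: g2; rewrite in_itv /= cs.
Qed.

Lemma ae_deriveW a b c t x (P Q : R -> set E) : a <= c -> t <= b ->
  (forall s v, c <= s <= t -> P s v -> Q s v) ->
  ae_derive a b x P -> ae_derive c t x Q.
Proof.
move=> ac tb PQ /ae_mono; apply => s h; rewrite in_itv /= => /andP[cs st].
have [|ds Ps] := h; first by rewrite in_itv /=; apply/andP; split; lra.
by split => //; apply: PQ => //; rewrite cs.
Qed.

Lemma trajectory_concat T F t0 t (x0 : E) y z : t0 <= t <= T ->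
  is_arc t0 t y -> ae_derive t0 t y (fun s => F (y s)) -> y t0 = x0 ->
  trajectory T F t (y t) z ->
  trajectory T F t0 x0 (fun s => if s <= t then y s else z s).
Proof.
move=> /andP[t0t tT] ya yd y0 [za zd zt]; set w := fun s => _.
have wy s : s <= t -> w s = y s by rewrite /w => ->.
have wz s : t <= s -> w s = z s.
  move=> ts; rewrite /w; case: ifPn => // st.
  by have -> : s = t by apply/eqP; rewrite eq_le st.
split; last by rewrite wy.
- apply: (@is_arc_glue _ _ t); first by rewrite t0t.
    by apply: is_arc_eq ya => s /andP[_ st]; rewrite wy.
  by apply: is_arc_eq za => s /andP[ts _]; rewrite wz.
- apply: (@ae_derive_glue _ _ t).
    apply: (@ae_derive_eq _ _ y); first by move=> s /andP[_ /ltW st]; rewrite wy.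
    by apply: ae_deriveW yd => // s v /andP[_ st]; rewrite wy.
  apply: (@ae_derive_eq _ _ z); first by move=> s /andP[/ltW ts _]; rewrite wz.
  by apply: ae_deriveW zd => // s v /andP[ts _]; rewrite wz.
Qed.

Lemma trajectory_restrict T F t0 t (x0 : E) y : t0 <= t ->
  trajectory T F t0 x0 y -> trajectory T F t (y t) y.
Proof.
move=> t0t [ya yd _]; split => //; first exact: is_arcW ya t0t (lexx _).
exact: ae_deriveW yd.
Qed.

(** Gronwall estimate, obtained by multiplying local estimates along a fine
partition. *)
Lemma trajectory_bounded T F t0 (x0 : E) (gamma : R) y : 0 < gamma -> t0 <= T ->
  (forall (u v : E), F u v -> enorm v <= gamma * (1 + enorm u)) ->
  trajectory T F t0 x0 y -> 
  1 + enorm (y T) <= (1 + enorm x0) * expR (2 * gamma * (T - t0)).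
Proof.
move=> g0 tT Fg [ya yd yt0].
pose Q c := 1 + enorm (y T) <= (1 + enorm (y c)) * expR (2 * gamma * (T - c)).
suff : Q t0 by rewrite /Q yt0.
apply: (@interval_induction R t0 T Q tT).
  by rewrite /Q subrr mulr0 expR0 mulr1.
move=> s /andP[t0s sT]; have e4 : 0 < 4^-1 :> R by rewrite invr_gt0.
have [d d0 dP] := is_arc_continuous ya e4.
exists d => // c e t0c cs se eT sdc esd Qe.
(* With a variation below 1/4 the speed is at most twice gamma (1 + |y c|). *)
have near_s r : c <= r -> r <= e -> enorm (y r - y s) < 4^-1.
  move=> cr re; have [rs|/ltW sr] := leP r s.
    by rewrite enormBC; apply: dP => //; lra.
  by apply: dP => //; lra.
have ce : c <= e by lra.
have ysn := enorm_ge0 (y s).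
have h1 : enorm (y e - y c) <= (gamma * (1 + (enorm (y s) + 4^-1))) * (e - c).
  apply: arc_le_speed => //; first by rewrite mulr_ge0 ?ltW //; lra.
    exact: is_arcW ya t0c eT.
  suff : ae_derive c e y (fun _ v => enorm v <= gamma * (1 + (enorm (y s) + 4^-1))) by [].
  apply: ae_deriveW yd => // r v /andP[cr re] /Fg vr; rewrite (le_trans vr) //.
  rewrite ler_pM2l // lerD2l -[y r](subrK (y s)) (le_trans (enorm_triangle _ _)) //.
  by have := near_s r cr re; lra.
have h2 : enorm (y s) <= enorm (y c) + 4^-1.
  have := near_s c (lexx _) ce; have := enorm_triangleB (y c) (y s) 0.
  by rewrite !subr0 enormBC; lra.
have h3 : 1 + enorm (y e) <= (1 + enorm (y c)) * (1 + 2 * gamma * (e - c)).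
  have := enorm_triangleB (y c) (y e) 0; rewrite !subr0 => h4.
  have h5 : gamma * (1 + (enorm (y s) + 4^-1)) * (e - c)
     <= gamma * (2 * (1 + enorm (y c))) * (e - c).
    by rewrite ler_wpM2r ?subr_ge0 // ler_pM2l //; have := enorm_ge0 (y c); lra.
  by move: h1 h4 h5; clear; lra.
have h4 : 1 + 2 * gamma * (e - c) <= expR (2 * gamma * (e - c)) by exact: expR_ge1Dx.
rewrite /Q (le_trans Qe) //.
have -> : 2 * gamma * (T - c) = 2 * gamma * (e - c) + 2 * gamma * (T - e) by ring.
rewrite expRD mulrA ler_wpM2r ?expR_ge0 // (le_trans h3) // ler_wpM2l //.
by rewrite addr_ge0 // enorm_ge0.
Qed.

End Trajectories.

Section Value.
Context {R : realType} {n : nat}.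
Local Notation E := 'rV[R]_n.
Variables (T : R) (F : E -> set E) (phi : E -> R).
Hypothesis FG : SH_iii F.
Hypothesis phiL : locally_lipschitz phi.

Lemma locally_lipschitz_continuous : continuous phi.
Proof.
move=> x; have [K Kx phiK] := phiL x.
have [M [M0 HM]] : exists M, 0 < M /\ forall y, K y -> `|phi x - phi y| <= M * `|x - y|.
  near (pinfty_nbhs R) => M; exists M; split; first by near: M; exact: nbhs_pinfty_gt.
  move=> y Ky; have : M.-lipschitz_K phi by near: M; exact: phiK.
  by move=> /(_ (x, y)); apply; split => //=; exact: nbhs_singleton.
apply/(cvgrPdist_le (F := nbhs x) (FF := nbhs_filter x)) => e e0.
have nx : nbhs x (eball x (e / M)) by apply/nbhs_eballP; exists (e / M) => //; rewrite divr_gt0.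
apply: (@filterS _ (nbhs x) (nbhs_filter x) _ _ _ (filterI Kx nx)) => y [Ky].
rewrite /eball /= => xy; rewrite (le_trans (HM _ Ky)) // mulrC -ler_pdivlMr //.
by rewrite (le_trans (norm_le_enorm _)) // enormBC.
Unshelve. all: by end_near. Qed.

Lemma value_le_of_trajectory t0 (x0 : E) y : t0 <= T -> trajectory T F t0 x0 y ->
  value T F phi t0 x0 <= phi (y T).
Proof.
move=> tT yT; have [gamma g0 Fg] := FG.
apply: ge_inf; last by exists y.
pose r := (1 + enorm x0) * expR (2 * gamma * (T - t0)).
have B0 : eball (0 : E) r !=set0.
  exists 0; rewrite /eball /= subrr enorm0 mulr_ge0 ?expR_ge0 // addr_ge0 //.
  exact: enorm_ge0.
have [v _ vmin] := compact_EVT_min B0 (@eball_compact R n 0 r)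
  (continuous_subspaceT locally_lipschitz_continuous).
exists (phi v) => _ [z zT <-]; apply: vmin; rewrite inE /eball /= subr0.
have := trajectory_bounded g0 tT Fg zT; rewrite -/r; lra.
Qed.

(** Every trajectory that competes at (t, y t), preceded by y, competes at (t0, y t0). *)
Lemma value_nondecreasing t0 t y : t0 <= t <= T ->
  is_arc t0 t y -> ae_derive t0 t y (fun s => F (y s)) ->
  (exists z, trajectory T F t (y t) z) ->
  value T F phi t0 (y t0) <= value T F phi t (y t).
Proof.
move=> tT ya yd [z0 z0T]; have /andP[t0t tT'] := tT.
apply: lb_le_inf; first by exists (phi (z0 T)); exists z0.
move=> _ [z zT <-].
have := value_le_of_trajectory (le_trans t0t tT') (trajectory_concat tT ya yd (erefl _) zT).
case: ifPn => // Tt; suff -> : z T = y T by [].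
have -> : T = t by apply/eqP; rewrite eq_le tT' Tt.
by case: zT.
Qed.

Lemma value_optimal t0 (x0 : E) x t : t0 <= t <= T -> optimal T F phi t0 x0 x ->
  value T F phi t (x t) <= value T F phi t0 x0.
Proof.
move=> /andP[t0t tT] [xT xmin].
apply: (@le_trans _ _ (phi (x T))).
  by apply: value_le_of_trajectory => //; exact: trajectory_restrict xT.
apply: lb_le_inf; first by exists (phi (x T)); exists x.
by move=> _ [z zT <-]; exact: xmin.
Qed.

End Value.

(** * Averaged velocities along the optimal pair *)

Section Averages.
Context {R : realType} {n : nat}.
Local Notation E := 'rV[R]_n.
Local Notation mu := (@lebesgue_measure R).
Implicit Types (F : E -> set E) (x p : R -> E) (W : set E) (u v w z q : E)
  (a b s t l e k L C : R).

Definition near_continuous a b x := forall s e, a <= s -> s <= b -> 0 < e ->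
  exists2 d : R, 0 < d & forall t, a <= t -> t <= b -> s - d < t -> t < s + d ->
    enorm (x t - x s) <= e.

Lemma is_arc_near_continuous a b x : is_arc a b x -> near_continuous a b x.
Proof.
move=> xa s e as_ sb e0; have [d d0 dP] := is_arc_continuous xa e0.
exists d => // t at_ tb sdt tsd; apply: ltW.
have [st|/ltW ts] := leP s t; first by apply: dP => //; lra.
by rewrite enormBC; apply: dP => //; lra.
Qed.

(** Form without derivatives of: x' maximises <., p> over F x. *)
Definition average_velocity F a b x p := forall s e, a <= s -> s <= b -> 0 < e ->
  exists2 d : R, 0 < d & forall l t, a <= l -> l <= s -> s <= t -> t <= b ->
    s - d < l -> t < s + d ->
    exists2 v, F (x s) v & dotp v (p s) = hamiltonian F (x s) (p s) /\
      enorm (x t - x l - (t - l) *: v) <= e * (t - l).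

(** The subgradient inequality satisfied by -p', frozen at the tag s and integrated over
a short interval, uniformly in the displacement z. *)
Definition average_adjoint F a b C x p := forall s e, a <= s -> s <= b -> 0 < e ->
  exists2 d : R, 0 < d & forall l t, a <= l -> l <= s -> s <= t -> t <= b ->
    s - d < l -> t < s + d -> forall z, enorm z <= 1 ->
    - (hamiltonian F (x s + z) (p s) - hamiltonian F (x s) (p s)
       + C * enorm z ^+ 2 + e) * (t - l) <= dotp (p t - p l) z.

(** In <p t, z> - <p l, z'> the variation of H between x s and x s + z appears twice with
opposite signs: from the increment of p and from that of z. *)
Lemma tracking_step_of_averages F a b k C x p : 0 <= k ->
  near_continuous a b p ->
  average_velocity F a b x p -> average_adjoint F a b C x p ->
  (forall s z v, a <= s -> s <= b -> enorm z <= 1 -> F (x s) v ->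
     dotp v (p s) = hamiltonian F (x s) (p s) ->
     exists2 w, F (x s + z) w &
       dotp w (p s) = hamiltonian F (x s + z) (p s) /\ enorm (w - v) <= k * enorm z) ->
  tracking_step F a b k C x p.
Proof.
move=> k0 pc xv pv sel s e as_ sb e0.
have p0 := enorm_ge0 (p s).
have c0 : 0 < enorm (p s) + k + 2 by lra.
pose e1 := Num.min 1 (e / (enorm (p s) + k + 2)).
have e10 : 0 < e1 by rewrite lt_min ltr01 divr_gt0.
have e11 : e1 <= 1 by rewrite ge_min lexx.
have e1e : e1 * (enorm (p s) + k + 2) <= e.
  by rewrite -ler_pdivlMr // ge_min lexx orbT.
have [d1 d10 d1P] := pc s e1 as_ sb e10.
have [d2 d20 d2P] := xv s e1 as_ sb e10.
have [d3 d30 d3P] := pv s e1 as_ sb e10.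
pose d := Num.min d1 (Num.min d2 d3).
have dd1 : d <= d1 by rewrite ge_min lexx.
have dd2 : d <= d2 by rewrite !ge_min lexx !orbT.
have dd3 : d <= d3 by rewrite !ge_min lexx !orbT.
exists d; first by rewrite !lt_min d10 d20.
move=> l t al ls st tb sdl tsd z z1.
have [v Fv [vp hv]] : exists2 v, F (x s) v &
    dotp v (p s) = hamiltonian F (x s) (p s) /\
    enorm (x t - x l - (t - l) *: v) <= e1 * (t - l) by apply: d2P; lra.
have hp := d3P l t al ls st tb ltac:(lra) ltac:(lra) z z1.
have pl : enorm (p l - p s) <= e1 by apply: d1P; lra.
have [w Fw [wp wv]] := sel s z v as_ sb z1 Fv vp.
exists w => // z'.
have tl : 0 <= t - l by lra.
have z'E : z' - z = (x t - x l - (t - l) *: v) - (t - l) *: (w - v).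
  by rewrite /z'; apply/rowP => i; rewrite !mxE; ring.
have h1 : enorm (z' - z) <= (t - l) * (k * enorm z + e1).
  rewrite z'E (le_trans (enorm_triangle _ _)) // enormN enormZ ger0_norm //.
  have : (t - l) * enorm (w - v) <= (t - l) * (k * enorm z) by rewrite ler_wpM2l.
  by move: hv; clear; lra.
have kz : k * enorm z <= k by rewrite ler_piMr.
have e1e' : e1 <= e.
  rewrite (le_trans _ e1e) // ler_peMr ?(ltW e10) //; lra.
split; first by rewrite (le_trans h1) // ler_wpM2l // lerD2l.
have -> : dotp (p t) z - dotp (p l) z' =
    dotp (p t - p l) z - dotp (p s) (z' - z) - dotp (p l - p s) (z' - z).
  by rewrite !(dotpBl, dotpBr); ring.
have h2 : dotp (p l - p s) (z' - z) <= e1 * ((t - l) * (k + 1)).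
  rewrite (le_trans (dotp_le _ _)) // ler_pM ?enorm_ge0 // (le_trans h1) //.
  by rewrite ler_wpM2l // lerD.
have h3 : dotp (p s) (z' - z) <= enorm (p s) * (e1 * (t - l))
   - (t - l) * (hamiltonian F (x s + z) (p s) - hamiltonian F (x s) (p s)).
  rewrite z'E dotpBr dotpZr dotpBr !(dotpC (p s)) wp vp lerB //.
  by rewrite dotpC (le_trans (dotp_le _ _)) // ler_wpM2l ?enorm_ge0.
have h4 : (t - l) * (e1 * (enorm (p s) + k + 2)) <= (t - l) * e by rewrite ler_wpM2l.
by move: hp h2 h3 h4; clear; lra.
Qed.

(** The unit neighbourhood of the curve, where all the estimates are uniform. *)
Definition tube a b x : set E :=
  [set u | exists s z, [/\ a <= s, s <= b, enorm z <= 1 & u = x s + z]].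

Section FromDerivatives.
Variables (F : E -> set E) (a b k L : R) (x p : R -> E).
Hypothesis FP : SH_i F.
Hypotheses (k0 : 0 <= k) (L0 : 0 < L).
Hypotheses (x_arc : is_arc a b x) (p_arc : is_arc a b p).
Local Notation W := (tube a b x).
Hypothesis H_lip : forall u v q, W u -> W v ->
  hamiltonian F u q <= hamiltonian F v q + k * enorm (u - v) * enorm q.
Hypothesis F_bound : forall u v, W u -> F u v -> enorm v <= L.

Lemma hamiltonian_joint_le u v q q' : W u -> W v ->
  hamiltonian F u q <= hamiltonian F v q' + (k * enorm (u - v) * enorm q' + L * enorm (q - q')).
Proof.
move=> Wu Wv; apply: hamiltonian_le => // w Fw.
have -> : dotp w q = dotp w (q - q') + dotp w q' by rewrite -dotpDr subrK.
have h1 : dotp w q' <= hamiltonian F v q' + k * enorm (u - v) * enorm q'.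
  exact: le_trans (le_hamiltonian FP q' Fw) (H_lip q' Wu Wv).
have h2 : dotp w (q - q') <= L * enorm (q - q').
  by rewrite (le_trans (dotp_le _ _)) // ler_wpM2r ?enorm_ge0 // (F_bound Wu).
lra.
Qed.

Lemma in_tube s z : a <= s -> s <= b -> enorm z <= 1 -> W (x s + z).
Proof. by move=> as_ sb z1; exists s, z. Qed.

Lemma in_tube0 s : a <= s -> s <= b -> W (x s).
Proof. by move=> as_ sb; rewrite -[x s]addr0; apply: in_tube; rewrite ?enorm0. Qed.

Lemma near_continuous_pair s e : a <= s -> s <= b -> 0 < e ->
  exists2 d : R, 0 < d & forall t, a <= t -> t <= b -> s - d < t -> t < s + d ->
    enorm (x t - x s) <= e /\ enorm (p t - p s) <= e.
Proof.
move=> as_ sb e0.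
have [d1 d10 d1P] := is_arc_near_continuous x_arc as_ sb e0.
have [d2 d20 d2P] := is_arc_near_continuous p_arc as_ sb e0.
exists (Num.min d1 d2); first by rewrite lt_min d10.
have dd1 : Num.min d1 d2 <= d1 by rewrite ge_min lexx.
have dd2 : Num.min d1 d2 <= d2 by rewrite ge_min lexx orbT.
by move=> t at_ tb h1 h2; split; [apply: d1P|apply: d2P] => //; lra.
Qed.

(** The mean velocity is close to F (x s) by convexity, and nearly maximises <., p s>;
argmax_gap turns this into closeness to a maximiser. *)
Lemma average_velocity_of_ae_derive :
  ae_derive a b x (fun s v => F (x s) v /\ hamiltonian F (x s) (p s) <= dotp v (p s)) ->
  average_velocity F a b x p.
Proof.
move=> xd s e as_ sb e0.
have [g g0 gP] := argmax_gap FP (x s) (p s) (divr_gt0 e0 (ltr0Sn R 1)).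
have L0_ := L0.
have ps := enorm_ge0 (p s).
have kps : 0 <= k * enorm (p s) by rewrite mulr_ge0.
have c1 : 0 < 2 * L + 2 * k * enorm (p s) by lra.
have k1 : 0 < k + 1 by move: k0; lra.
pose eta := Num.min (e / 2 / (k + 1)) (g / (2 * L + 2 * k * enorm (p s))).
have eta0 : 0 < eta by rewrite lt_min !divr_gt0.
have eta1 : eta * (k + 1) <= e / 2 by rewrite -ler_pdivlMr // ge_min lexx.
have eta2 : eta * (2 * L + 2 * k * enorm (p s)) <= g.
  by rewrite -ler_pdivlMr // ge_min lexx orbT.
have [d d0 dP] := near_continuous_pair as_ sb eta0.
exists d => // l t al ls st tb sdl tsd.
have Ws := in_tube0 as_ sb.
have near_s r : r \in `[l, t] -> [/\ W (x r), enorm (x r - x s) <= eta & enorm (p r - p s) <= eta].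
  rewrite in_itv /= => /andP[lr rt].
  have [||||h1 h2] := dP r; try lra.
  by split => //; apply: in_tube0; lra.
have [ltE|lt_neq] := eqVneq l t.
  have [v Fv [vp _]] := hamiltonian_attained FP (x s) (p s).
  by exists v => //; rewrite ltE !subrr scale0r subrr enorm0 mulr0.
have tl : 0 < t - l by rewrite subr_gt0 lt_neqAle lt_neq (le_trans ls).
have lt_ : l <= t by lra.
have x_arc' := is_arcW x_arc al tb.
have slope q (M : R) : (forall r v, r \in `[l, t] -> F (x r) v ->
    hamiltonian F (x r) (p r) <= dotp v (p r) -> dotp v q <= M) ->
    dotp ((t - l)^-1 *: (x t - x l)) q <= M.
  move=> qM; rewrite dotpZl mulrC ler_pdivrMr //; apply: arc_le_slope => //.
  apply: (ae_mono xd) => r h rlt.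
  have [|dr [Fr Hr]] := h.
    by move: rlt; rewrite !in_itv /= => /andP[? ?]; apply/andP; split; lra.
  by split => //; exact: (qM r).
set v0 := (t - l)^-1 *: (x t - x l) in slope.
have ke : 0 <= k * eta by rewrite mulr_ge0 // ltW.
have [q|u Fu uv0] := dist_le_of_hamiltonian FP (x := x s) (v := v0) ke.
  apply: slope => r v /near_s[Wr xr _] Fv _.
  rewrite (le_trans (le_hamiltonian FP q Fv)) // (le_trans (H_lip q Wr Ws)) //.
  by rewrite lerD2l ler_wpM2r ?enorm_ge0 // ler_wpM2l.
have v0p : hamiltonian F (x s) (p s) - eta * (2 * L + k * enorm (p s)) <= dotp v0 (p s).
  rewrite -lerN2 -dotpNr; apply: slope => r v /near_s[Wr xr pr] Fv Hv.
  have h1 : hamiltonian F (x s) (p s) <=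
      hamiltonian F (x r) (p s) + eta * (k * enorm (p s)).
    rewrite (le_trans (H_lip (p s) Ws Wr)) // lerD2l mulrA (mulrC eta).
    by rewrite ler_wpM2r // ler_wpM2l // enormBC.
  have h2 : hamiltonian F (x r) (p s) <= hamiltonian F (x r) (p r) + eta * L.
    rewrite (le_trans (hamiltonian_joint_le (p s) (p r) Wr Wr)) // lerD2l.
    by rewrite subrr enorm0 mulr0 mul0r add0r enormBC mulrC ler_pM2r.
  have h3 : dotp v (p r - p s) <= eta * L.
    rewrite (le_trans (dotp_le _ _)) // mulrC ler_pM ?enorm_ge0 //.
    exact: F_bound Fv.
  rewrite dotpBr in h3; rewrite dotpNr.
  by move: Hv h1 h2 h3; lra.
have [|v Fv [vp uv]] := gP u Fu.
  have : dotp (v0 - u) (p s) <= k * eta * enorm (p s).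
    by rewrite (le_trans (dotp_le _ _)) // ler_wpM2r ?enorm_ge0.
  by rewrite dotpBl; move: v0p eta2; lra.
exists v => //; split => //.
have -> : x t - x l - (t - l) *: v = (t - l) *: (v0 - v).
  by rewrite scalerBr /v0 scalerA mulfV ?scale1r // gt_eqF.
rewrite enormZ gtr0_norm // mulrC ler_pM2r //.
rewrite (le_trans (enorm_triangleB u _ _)) //.
by move: uv0 uv eta1 eta0; lra.
Qed.

Lemma average_adjoint_of_ae_derive (C : R) : 0 <= C ->
  ae_derive a b p (fun s q => forall z, enorm z <= 1 ->
    - C * enorm z ^+ 2 <= hamiltonian F (x s + z) (p s) - hamiltonian F (x s) (p s)
                          + dotp q z) ->
  average_adjoint F a b C x p.
Proof.
move=> C0 pd s e as_ sb e0; have L0_ := L0.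
have ps := enorm_ge0 (p s).
have kps : 0 <= k * enorm (p s) by rewrite mulr_ge0.
have c1 : 0 < 2 * (L + k * enorm (p s)) by lra.
pose eta := e / (2 * (L + k * enorm (p s))).
have eta0 : 0 < eta by rewrite divr_gt0.
have etaE : eta * (2 * (L + k * enorm (p s))) = e by rewrite mulfVK // gt_eqF.
have [d d0 dP] := near_continuous_pair as_ sb eta0.
exists d => // l t al ls st tb sdl tsd z z1.
have lt_ : l <= t by lra.
rewrite -lerN2 -dotpNr mulNr opprK.
apply: arc_le_slope => //; first exact: is_arcW p_arc al tb.
apply: (ae_mono pd) => r h; rewrite in_itv /= => /andP[lr rt].
have [|dr /(_ z z1) Hr] := h; first by rewrite in_itv /=; apply/andP; split; lra.
split => //; rewrite dotpNr.
have [||||xr pr] := dP r; try lra.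
have Ws := in_tube0 as_ sb; have Wsz := in_tube as_ sb z1.
have ar : a <= r by lra.
have rb : r <= b by lra.
have Wr := in_tube0 ar rb; have Wrz := in_tube ar rb z1.
have h1 : hamiltonian F (x r + z) (p r) <= hamiltonian F (x s + z) (p s)
    + eta * (L + k * enorm (p s)).
  rewrite (le_trans (hamiltonian_joint_le (p r) (p s) Wrz Wsz)) // lerD2l.
  have -> : x r + z - (x s + z) = x r - x s.
    by apply/rowP => i; rewrite !mxE; ring.
  rewrite mulrDr addrC lerD //; first by rewrite mulrC ler_pM2r.
  by rewrite mulrA (mulrC eta) ler_wpM2r // ler_wpM2l.
have h2 : hamiltonian F (x s) (p s) <= hamiltonian F (x r) (p r)
    + eta * (L + k * enorm (p s)).
  have h3 : hamiltonian F (x s) (p s) <=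
      hamiltonian F (x r) (p s) + eta * (k * enorm (p s)).
    rewrite (le_trans (H_lip (p s) Ws Wr)) // lerD2l mulrA (mulrC eta).
    by rewrite ler_wpM2r // ler_wpM2l // enormBC.
  have h4 : hamiltonian F (x r) (p s) <= hamiltonian F (x r) (p r) + eta * L.
    rewrite (le_trans (hamiltonian_joint_le (p s) (p r) Wr Wr)) // lerD2l.
    by rewrite subrr enorm0 mulr0 mul0r add0r enormBC mulrC ler_pM2r.
  by move: h3 h4; lra.
by move: Hr h1 h2 etaE; lra.
Qed.

End FromDerivatives.
End Averages.

(** * Time reversal *)

Section Reversal.
Context {R : realType} {n : nat}.
Local Notation E := 'rV[R]_n.
Implicit Types (F : E -> set E) (x p y : R -> E) (u v w z q : E)
  (a b s t l e k L C : R).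

Lemma is_arc_bounded a b x : a <= b -> is_arc a b x ->
  exists2 M : R, 0 < M & forall s, a <= s -> s <= b -> enorm (x s) <= M.
Proof.
move=> ab xa.
suff [M MP] : exists M : R, forall s, a <= s -> s <= b -> enorm (x s) <= M.
  exists (M + 1); first by have := MP a (lexx _) ab; have := enorm_ge0 (x a); lra.
  by move=> s as_ sb; rewrite (le_trans (MP s as_ sb)) // lerDl.
apply: (@interval_induction R a b
  (fun c => exists M : R, forall s, c <= s -> s <= b -> enorm (x s) <= M) ab).
  exists (enorm (x b)) => s bs sb.
  by have -> : s = b by apply/eqP; rewrite eq_le sb.
move=> s /andP[as_ sb].
have [d d0 dP] := is_arc_near_continuous xa as_ sb ltr01.
exists d => // c e ac cs se eb sdc esd [M MP].
exists (Num.max M (1 + enorm (x s))) => r cr rb; rewrite le_max.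
have [er|/ltW re] := leP e r; first by rewrite MP.
have h : enorm (x r - x s) <= 1 by apply: dP; lra.
apply/orP; right; rewrite -{1}[x r](subrK (x s)).
by rewrite (le_trans (enorm_triangle _ _)) // lerD2r.
Qed.

Lemma oppF_SH_i F : SH_i F -> SH_i (oppF F).
Proof.
move=> FP x; have [[v Fv] Fcv Fc] := FP x; split.
- by exists (- v); exists v.
- move=> _ _ l /[!inE] -[u Fu <-] [w Fw <-].
  exists (conv l (u : convex_lmodType E) w).
    by have := Fcv u w l; rewrite !inE; apply.
  by rewrite /conv /= opprD !scalerN.
- apply: continuous_compact Fc; apply: continuous_subspaceT => u.
  exact: opp_continuous.
Qed.

Lemma oppF_SH_ii F : SH_ii F -> SH_ii (oppF F).
Proof.
move=> FL x; have [K [c [Kx c0 KP]]] := FL x; exists K, c; split => // z y Kz Ky.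
move=> _ [v Fv <-]; have [w Fw [u u1 <-]] := KP z y Kz Ky v Fv.
exists (- w); first by exists w.
exists (- u); first by move: u1; rewrite /eball /= !subr0 enormN.
by rewrite scalerN opprD.
Qed.

(** Solutions with a prescribed initial value near the initial value of x: the
time-reversed curve is tracked backwards for the inclusion -F, with p = 0. *)
Lemma forward_tracking F a b k L x p u : SH_i F -> SH_ii F -> a <= b -> 0 <= k -> 0 < L ->
  near_continuous a b x -> average_velocity F a b x p ->
  (forall s z w, a <= s -> s <= b -> enorm z <= 1 -> F (x s + z) w -> enorm w <= L) ->
  (forall s z v, a <= s -> s <= b -> enorm z <= 1 -> F (x s) v ->
     exists2 w, F (x s + z) w & enorm (w - v) <= k * enorm z) ->
  u != 0 -> expR (k * (b - a)) * (2 * enorm u) <= 1 ->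
  exists y, [/\ y a = x a + u, curve_lipschitz L a b y & increments_in F a b y].
Proof.
move=> FP FL ab k0 L0 xc xv Fb sel u0 u1.
have GP := oppF_SH_i FP; have GL := oppF_SH_ii FL.
pose x' s := x (- s).
have flip s : - b <= s -> s <= - a -> a <= - s /\ - s <= b by move=> ? ?; lra.
have G_bound s z w : - b <= s -> s <= - a -> enorm z <= 1 -> oppF F (x' s + z) w -> enorm w <= L.
  move=> bs sa z1 [v Fv <-]; have [? ?] := flip s bs sa.
  by rewrite enormN; apply: (Fb (- s) z).
have xc' : near_continuous (- b) (- a) x'.
  move=> s e bs sa e0; have [as_ sb] := flip s bs sa.
  have [d d0 dP] := xc _ _ as_ sb e0; exists d => // t bt ta h1 h2.
  by apply: dP; lra.
have xv' : average_velocity (oppF F) (- b) (- a) x' (fun=> 0).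
  move=> s e bs sa e0; have [as_ sb] := flip s bs sa.
  have [d d0 dP] := xv _ _ as_ sb e0; exists d => // l t bl ls st ta h1 h2.
  have [||||||v Fv [_ hv]] := dP (- t) (- l); try lra.
  exists (- v); first by exists v.
  rewrite dotp0r hamiltonian0 //; split => //.
  have -> : x' t - x' l - (t - l) *: - v = - (x (- l) - x (- t) - (- l - - t) *: v).
    by rewrite /x'; apply/rowP => i; rewrite !mxE; ring.
  by rewrite enormN (le_trans hv) // opprK [- l + t]addrC.
have xp' : average_adjoint (oppF F) (- b) (- a) 0 x' (fun=> 0).
  move=> s e bs sa e0; exists 1 => // l t bl ls st ta _ _ z _.
  rewrite !hamiltonian0 // !subrr mul0r !add0r dotp0l mulNr oppr_le0.
  by rewrite mulr_ge0 ?(ltW e0) // subr_ge0 (le_trans ls).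
have pc' : near_continuous (- b) (- a) (fun=> 0 : E).
  by move=> s e _ _ e0; exists 1 => // t _ _ _ _; rewrite subrr enorm0 ltW.
have step : tracking_step (oppF F) (- b) (- a) k 0 x' (fun=> 0).
  apply: tracking_step_of_averages => // s z _ bs sa z1 [v Fv <-] _.
  have [as_ sb] := flip s bs sa.
  have [w Fw wv] := sel (- s) z v as_ sb z1 Fv.
  exists (- w); first by exists w.
  by rewrite dotp0r hamiltonian0 //; split => //; rewrite -opprD enormN.
have ba : - b <= - a by rewrite lerN2.
have u1' : expR (k * (- a - - b)) * (2 * enorm u) <= 1 by rewrite opprK addrC.
have [y [yb yL yF _ _]] := tracking_curve GP GL ba k0 (lexx 0) L0 (enorm_gt0 u0)
  (lexx _) u1' G_bound xc' step.
exists (fun s => y (- s)); split.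
- by rewrite yb /x' opprK.
- move=> s t as_ st tb; rewrite enormBC.
  have -> : t - s = - s - - t by ring.
  by apply: yL; lra.
- exact: increments_in_reverse.
Qed.

End Reversal.

(** * Propagation of the proximal inequality *)

Section ProximalInequality.
Context {R : realType} {n : nat}.
Local Notation E := 'rV[R]_n.
Implicit Types (f : E -> R) (x q h : E).

Lemma prox_subdiff_of_ball f x q (c r : R) : 0 <= c -> 0 < r ->
  (forall h, eball 0 r h -> dotp q h - c * enorm h ^+ 2 <= f (x + h) - f x) ->
  prox_subdiff f x q.
Proof.
move=> c0 r0 fP; exists c, r; split => // y yx.
have := fP (y - x); rewrite /eball /= subr0 => /(_ yx).
by rewrite [x + _]addrC subrK; lra.
Qed.

Lemma subjet_of_ball f x q (c r : R) : 0 < r ->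
  (forall h, eball 0 r h -> dotp q h - c * enorm h ^+ 2 <= f (x + h) - f x) ->
  subjet f x (q, (- (2 * c)) *: 1%:M).
Proof.
move=> r0 fP; split => /=; first by rewrite linearZ /= trmx1.
exists (fun=> 0), r; split => //.
  apply/eqoP => e e0; apply: (@filterS _ (nbhs x) (nbhs_filter x) _ _ _ (@filterT _ _ _)).
  by move=> y _; rewrite normr0 mulr_ge0 // ltW.
move=> y yx; have := fP (y - x); rewrite /eball /= subr0 => /(_ yx).
rewrite [x + _]addrC subrK addr0 -scalemxAr mulmx1 dotpZl -enorm_sqr.
by lra.
Qed.

End ProximalInequality.

Theorem theorem3p1 (R : realType) (n : nat) (T : R)
    (F : 'rV[R]_n -> set 'rV[R]_n) (phi : 'rV[R]_n -> R)
    (hSH : SH F) (hH : H_hyp F) (hphi : locally_lipschitz phi)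
    (t0 : R) (x0 : 'rV[R]_n) (ht0 : t0 <= T)
    (xbar pbar : R -> 'rV[R]_n)
    (hopt : optimal T F phi t0 x0 xbar)
    (hparc : is_arc t0 T pbar)
    (hx : ae_derive t0 T xbar
            (fun s => frechet_subdiff (hamiltonian F (xbar s)) (pbar s)))
    (hp : ae_derive t0 T pbar
            (fun s q => frechet_subdiff (fun x => hamiltonian F x (pbar s))
                          (xbar s) (- q)))
    (hx0 : xbar t0 = x0)
    (hp0 : prox_subdiff (value T F phi t0) x0 (- pbar t0)) :
  exists c r : R, [/\ 0 < c, 0 < r,
    (forall t, t \in `[t0, T] -> forall h, eball 0 r h ->
      value T F phi t (xbar t + h) - value T F phi t (xbar t)
        >= dotp (- pbar t) h - c * enorm h ^+ 2) &
    (forall t, t \in `[t0, T] ->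
      prox_subdiff (value T F phi t) (xbar t) (- pbar t) /\
      subjet (value T F phi t) (xbar t) (- pbar t, (- c) *: 1%:M))].

Proof.
have [FP FL FG] := hSH; have [gamma g0 Fg] := FG.
have [xT _] := hopt; have [x_arc x_der _] := xT.
have [R0 R00 xR0] := is_arc_bounded ht0 x_arc.
have [P P0 pP] := is_arc_bounded ht0 hparc.
(* A ball that contains the unit neighbourhood of the optimal curve. *)
pose r0 := R0 + 1; have r00 : 0 < r0 by rewrite addr_gt0.
have [[c0 c00 Hsc] [dH [k k0 kH]]] := hH r0 r00.
pose W := eball (0 : 'rV[R]_n) r0.
have in_W s z : t0 <= s -> s <= T -> enorm z <= 1 -> W (xbar s + z).
  move=> ts sT z1; rewrite /W /eball /= subr0 (le_trans (enorm_triangle _ _)) //.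
  by rewrite lerD // xR0.
have in_W0 s : t0 <= s -> s <= T -> W (xbar s).
  by move=> ts sT; rewrite -[xbar s]addr0; apply: in_W => //; rewrite enorm0.
have sel := gradient_hamiltonian_selection FP k0 dH kH.
have H_lip u v q : W u -> W v ->
    hamiltonian F u q <= hamiltonian F v q + k * enorm (u - v) * enorm q.
  move=> Wu Wv; have [w Fw [wq _]] := hamiltonian_attained FP u q.
  have [w' Fw' [wq' ww']] := sel _ _ _ _ Wu Wv Fw wq.
  rewrite -wq -wq' -lerBlDl -dotpBl (le_trans (dotp_le _ _)) //.
  by rewrite ler_wpM2r ?enorm_ge0 // enormBC (enormBC u).
pose L := gamma * (1 + r0).
have L0 : 0 < L by rewrite mulr_gt0 // addr_gt0.
have F_boundW u v : W u -> F u v -> enorm v <= L.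
  rewrite /W /eball /= subr0 => ur /Fg /le_trans; apply.
  by rewrite ler_pM2l // lerD2l.
have F_bound s z w : t0 <= s -> s <= T -> enorm z <= 1 -> F (xbar s + z) w -> enorm w <= L.
  by move=> ts sT z1; apply: F_boundW; exact: in_W.
have tubeW : tube t0 T xbar `<=` W by move=> _ [s [z [ts sT z1 ->]]]; exact: in_W.
have tube_lip u v q : tube t0 T xbar u -> tube t0 T xbar v ->
    hamiltonian F u q <= hamiltonian F v q + k * enorm (u - v) * enorm q.
  by move=> /tubeW Wu /tubeW Wv; exact: H_lip.
have tube_bound u v : tube t0 T xbar u -> F u v -> enorm v <= L.
  by move=> /tubeW; exact: F_boundW.
have xv : average_velocity F t0 T xbar pbar.
  apply: (average_velocity_of_ae_derive FP k0 L0 x_arc hparc tube_lip tube_bound).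
  apply: (ae_mono (ae_and x_der hx)) => s [h1 h2] sT.
  have [dx Fx] := h1 sT; have [_ Px] := h2 sT.
  by split => //; split => //; exact: frechet_subdiff_hamiltonian_p Px.
pose C := c0 * P; have C0 : 0 <= C by rewrite mulr_ge0 // ltW.
have xp : average_adjoint F t0 T C xbar pbar.
  apply: (average_adjoint_of_ae_derive FP k0 L0 x_arc hparc tube_lip tube_bound C0).
  apply: (ae_mono hp) => s h sT; have [dp Pp] := h sT; split => // z z1.
  move: sT; rewrite in_itv /= => /andP[ts sT].
  have xz : enorm (xbar s) + enorm z <= r0 by rewrite lerD // xR0.
  have := frechet_subdiff_hamiltonian_x FP c00 Hsc xz Pp.
  rewrite dotpNl opprK; apply: le_trans.
  by rewrite ler_wpM2r ?sqr_ge0 // lerN2 ler_wpM2l // pP.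
have sel_x s z v : t0 <= s -> s <= T -> enorm z <= 1 -> F (xbar s) v ->
    forall q, dotp v q = hamiltonian F (xbar s) q ->
    exists2 w, F (xbar s + z) w &
      dotp w q = hamiltonian F (xbar s + z) q /\ enorm (w - v) <= k * enorm z.
  move=> ts sT z1 Fv q vq.
  have [w Fw [wq wv]] := sel _ _ _ _ (in_W0 s ts sT) (in_W s z ts sT z1) Fv vq.
  by exists w => //; split => //; rewrite [xbar s + z]addrC addrK in wv.
have step : tracking_step F t0 T k C xbar pbar.
  apply: tracking_step_of_averages => //; first exact: is_arc_near_continuous.
  by move=> s z v ts sT z1 Fv; exact: sel_x.
have [c1 [rho [c10 rho0 Vprox]]] := hp0.
pose G := expR (k * (T - t0)); have G0 : 0 < G := expR_gt0 _.
have expG s : 0 <= s -> s <= T - t0 -> expR (k * s) <= G.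
  by move=> s0 sT; rewrite ler_expR ler_wpM2l.
(* For |h| <= r the deviation 2 G |h| of y stays below 1 and below rho. *)
pose r := Num.min (1 / (2 * G)) (rho / (2 * G)).
have G2 : 0 < 2 * G by rewrite mulr_gt0.
have r_gt0 : 0 < r by rewrite lt_min !divr_gt0.
pose c := ((T - t0) * C + c1) * (2 * G) ^+ 2.
have c_ge0 : 0 <= c by rewrite mulr_ge0 ?sqr_ge0 // addr_ge0 // mulr_ge0 // subr_ge0.
have main t : t \in `[t0, T] -> forall h, eball 0 r h ->
    dotp (- pbar t) h - c * enorm h ^+ 2 <=
    value T F phi t (xbar t + h) - value T F phi t (xbar t).
  rewrite in_itv /= => /andP[t0t tT] h; rewrite /eball /= subr0 le_min => /andP[h1 h2].
  have [->|hN0] := eqVneq h 0.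
    by rewrite addr0 subrr dotp0r enorm0 expr0n /= mulr0 subr0.
  have h0 := enorm_gt0 hN0.
  have Gh1 : 2 * G * enorm h <= 1 by rewrite mulrC -ler_pdivlMr.
  have Ghr : 2 * G * enorm h <= rho by rewrite mulrC -ler_pdivlMr.
  have expB s : 0 <= s -> s <= T - t0 -> expR (k * s) * (2 * enorm h) <= 2 * G * enorm h.
    move=> s0 sT; rewrite mulrCA -mulrA ler_pM2l // ler_pM2r //; exact: expG.
  pose B := expR (k * (t - t0)) * (2 * enorm h).
  have BG : B <= 2 * G * enorm h by apply: expB; lra.
  have B0 : 0 <= B by rewrite mulr_ge0 ?expR_ge0 // mulr_ge0 // ltW.
  have B1 : B <= 1 by rewrite (le_trans BG).
  have stept : tracking_step F t0 t k C xbar pbar.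
    move=> s e ts st e0; have [d d0 dP] := step s e ts (le_trans st tT) e0.
    by exists d => // l t' tl ls st' t't; apply: dP => //; exact: le_trans tT.
  have [||y [yt yL yF yB yp]] := tracking_curve FP FL t0t k0 C0 L0 h0 (lexx _) B1 _ _ stept.
  - by move=> s z w ts st; apply: F_bound => //; exact: le_trans tT.
  - move=> s e ts st e0.
    have [d d0 dP] := is_arc_near_continuous x_arc ts (le_trans st tT) e0.
    by exists d => // t' tt' t't; apply: dP => //; exact: le_trans tT.
  have [z zT] : exists z, trajectory T F t (y t) z.
    have tw s : t <= s -> t0 <= s by move=> /(le_trans t0t).
    have [|||||z [zt zL zF]] :=
      @forward_tracking _ _ F t T k L xbar pbar h FP FL tT k0 L0 _ _ _ _ hN0 _.
    - move=> s e ts sT e0.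
      have [d d0 dP] := is_arc_near_continuous x_arc (tw _ ts) sT e0.
      by exists d => // t' tt' t'T; apply: dP => //; exact: tw.
    - move=> s e ts sT e0; have [d d0 dP] := xv s e (tw _ ts) sT e0.
      by exists d => // l t' tl; apply: dP; exact: tw.
    - by move=> s z w ts sT; apply: F_bound => //; exact: tw.
    - move=> s z v ts sT z1 Fv.
      have [|w Fw [_ wv]] := sel_x s z v (tw _ ts) sT z1 Fv 0; last by exists w.
      by rewrite dotp0r hamiltonian0.
    - by rewrite (le_trans (expB _ _ _)) //; lra.
    exists z; rewrite yt; split => //; first exact: curve_lipschitz_is_arc zL.
    exact: increments_in_ae_derive zL zF.
  have V1 : value T F phi t0 (y t0) <= value T F phi t (xbar t + h).
    rewrite -yt; apply: (value_nondecreasing FG hphi) => //; first by rewrite t0t.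
    - exact: curve_lipschitz_is_arc yL.
    - exact: increments_in_ae_derive yL yF.
    - by exists z.
  have V2 : value T F phi t (xbar t) <= value T F phi t0 x0.
    by apply: (value_optimal FG hphi _ hopt); rewrite t0t.
  have yrho : eball x0 rho (y t0).
    by rewrite /eball /= -hx0 (le_trans yB) // (le_trans BG).
  have V3 := Vprox _ yrho.
  rewrite -hx0 in V2 V3.
  set Z := y t0 - xbar t0 in yB yp V3.
  have ZB : enorm Z ^+ 2 <= B ^+ 2 by rewrite ler_pXn2r ?nnegrE ?enorm_ge0.
  have BG2 : B ^+ 2 <= (2 * G) ^+ 2 * enorm h ^+ 2.
    by rewrite -exprMn ler_pXn2r ?nnegrE // (le_trans B0).
  have D1 : c1 * enorm Z ^+ 2 <= c1 * ((2 * G) ^+ 2 * enorm h ^+ 2).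
    by rewrite ler_wpM2l // (le_trans ZB).
  have D2 : (t - t0) * (C * B ^+ 2) <= (T - t0) * (C * ((2 * G) ^+ 2 * enorm h ^+ 2)).
    apply: ler_pM; [by rewrite subr_ge0|by rewrite mulr_ge0 // sqr_ge0| |].
      by rewrite lerD2r.
    by rewrite ler_wpM2l.
  have cE : c * enorm h ^+ 2 = (T - t0) * (C * ((2 * G) ^+ 2 * enorm h ^+ 2))
      + c1 * ((2 * G) ^+ 2 * enorm h ^+ 2) by rewrite /c; ring.
  rewrite cE dotpNl; rewrite dotpNl in V3.
  have yp' : - ((t - t0) * (C * B ^+ 2)) <= dotp (pbar t) h - dotp (pbar t0) Z := yp.
  by move: V1 V2 V3 D1 D2 yp'; clear; lra.
(* The factor 2 compensates the factor 1/2 of the quadratic term of a subjet. *)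
exists (2 * (c + 1)), r.
have weaken t h : t \in `[t0, T] -> eball 0 r h ->
    dotp (- pbar t) h - (c + 1) * enorm h ^+ 2 <=
    value T F phi t (xbar t + h) - value T F phi t (xbar t).
  move=> tT hr; apply: le_trans (main t tT h hr).
  by rewrite lerD2l lerN2 ler_wpM2r ?sqr_ge0 // lerDl.
have c1_gt0 : 0 < c + 1 by rewrite ltr_wpDl.
split => //; first by rewrite mulr_gt0.
- move=> t tT h hr; apply: le_trans (weaken t h tT hr).
  by rewrite lerD2l lerN2 ler_wpM2r ?sqr_ge0 // ler_peMl ?(ltW c1_gt0) // ler1n.
- move=> t tT; split.
    apply: (@prox_subdiff_of_ball _ _ _ _ _ (c + 1) r) => //; first exact: ltW.
    by move=> h; exact: weaken.
  by apply: (@subjet_of_ball _ _ _ _ _ (c + 1) r) => // h; exact: weaken.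
Qed.
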